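(* Let $\mathscr B$ be a (separable) doubling ball-basis in a measure space $(X,\mu)$, $r\ge1$, and $\mathbb U$ a Banach space. Let $\omega$ be a modulus of continuity with $\|\omega\|=1+\int_0^1\frac{\omega(t)\log(1/t)}{t}dt<\infty$, let $\phi=\{\phi_B:B\in\mathscr B\}$ be an $\omega$-regular family of functions and let $\mathscr G=\bigcup_{x\in X}\mathscr G(x)$, where each $\mathscr G(x)$ is a family of balls complete at $x$. Then the maximal function $\mathcal M^{\phi,\mathscr G}$ is bounded from $\mathrm{BMO}(X,\mathbb U)$ to $\mathrm{BMO}(X,\mathbb R)$. More precisely, $$\|\mathcal M^{\phi,\mathscr G}(f)\|_{\mathrm{BMO}(X,\mathbb R)}\lesssim\|f\|_{\mathrm{BMO}(X,\mathbb U)}$$ for any function $f\in L^r(X,\mathbb U)\cap\mathrm{BMO}(X,\mathbb U)$.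
   Context: Ball-basis. Let $(X,\mathfrak M,\mu)$ be a measure space. A family $\mathscr B$ of measurable sets (balls) is a ball-basis if: (B1) $0<\mu(B)<\infty$ for $B\in\mathscr B$; (B2) any two points lie in a common ball; (B3) for any $E\in\mathfrak M$, $\varepsilon>0$ there is a finite or infinite sequence of balls $B_k$ with $\mu(E\triangle\bigcup_kB_k)<\varepsilon$; (B4) for any $B\in\mathscr B$ there is a ball $[B]\in\mathscr B$ with $B^*:=\bigcup_{A\in\mathscr B:\ \mu(A)\le2\mu(B),\ A\cap B\ne\varnothing}A\subset[B]$ and $\mu([B])\le\mathcal K\mu(B)$, $\mathcal K$ independent of $B$. All ball-bases are assumed separable (arbitrary unions of balls are measurable). $\mathscr B$ is doubling if there is $\eta>1$ such that for every ball $B$ with $B^*\ne X$ there is a ball $B'\supsetneq B$ with $\mu(B')\le\eta\mu(B)$. BMO. $\mathrm{BMO}(X,\mathbb U)$ is the space of measurable $\mathbb U$-valued functions $f$ with $\|f\|_{\mathrm{BMO}}=\sup_{B\in\mathscr B}\frac1{\mu(B)}\int_B\|f-f_B\|_{\mathbb U}<\infty$, $f_B=\frac1{\mu(B)}\int_Bf$. Volume distance: $d(x,B)=\inf\{\mu(A):A\in\mathscr B,\ A\supset B\cup\{x\}\}$. A modulus of continuity is a monotone increasing and subadditive function $\omega:(0,1]\to(0,1]$. A family of non-negative real valued functions $\phi=\{\phi_B:B\in\mathscr B\}\subset L^1(X)$ is $\omega$-regular if (1) $\|\phi_B\|_{L^1(X)}=1$; (2) there is an increasing function $\gamma:[1,\infty)\to[1,\infty)$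 with $\phi_B(x)\le\gamma(\mu(A)/\mu(B))\phi_A(x)$ for every two balls $B\subset A$; (3) there are positive constants $c_1,c_2$ such that for any ball $B$, $c_1\frac{\mathbf 1_B(x)}{\mu(B)}\le\phi_B(x)\le c_2\,\omega\big(\frac{\mu(B)}{d(x,B)}\big)\frac1{d(x,B)}$, $x\in X$. A family of balls $\mathscr G(x)\subset\mathscr B$ is complete at $x$ if $x\in B$ for any $B\in\mathscr G(x)$ and for any ball $A\ni x$ there is a ball $\bar A\in\mathscr G(x)$ with $\bar A\supset A$, $\mu(\bar A)\le\eta\mu(A)$, where $\eta\ge1$ is a constant (denoted by the same letter as the doubling constant). $\mathcal M^{\phi,\mathscr G}f(x)=\sup_{B\in\mathscr G(x)}\int_X\|f\|_{\mathbb U}\phi_B$, an operator acting from $L^r(X,\mathbb U)$ to the space $L^0(X,\mathbb R)$ of measurable functions. $a\lesssim b$ means $a\le c\,b$ with an admissible constant $c>0$, i.e. one depending only on $\mathcal K,\eta,r$.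
   Formalization: The constant in ≲ may depend, besides 𝒦, η, r, on c₁, c₂, γ of the ω-regular family φ and on ‖ω‖; with dependence on 𝒦, η, r only the claim is false (one φ_B concentrated on a small part of its ball, f a truncated logarithm). *)

(* Defs.v *)
From HB Require Import structures.
From mathcomp Require Import all_boot all_order all_algebra.
From mathcomp Require Import all_classical all_reals all_analysis.
From mathcomp Require Import measurable_realfun.

Set Implicit Arguments.
Unset Strict Implicit.
Unset Printing Implicit Defensive.

Import Order.TTheory GRing.Theory Num.Theory.
Import numFieldNormedType.Exports.

Local Open Scope classical_set_scope.
Local Open Scope ring_scope.

Section Bochner.
Context d (T : measurableType d) (R : realType).
Context (mu : {measure set T -> \bar R}) (U : completeNormedModType R).

Definition simple_fun (s : T -> U) : Prop :=
  finite_set (range s) /\ forall u : U, measurable (s @^-1` [set u]).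

Definition simple_integral (D : set T) (s : T -> U) : U :=
  \sum_(u \in range s) fine (mu (D `&` s @^-1` [set u])) *: u.

(* Everywhere limits of simple functions: every a.e.-class of strongly
   measurable functions has such a representative, and [fun x => `|f x|] is
   then measurable even when [mu] is not complete. *)
Definition strongly_measurable (f : T -> U) : Prop :=
  exists s : nat -> T -> U,
    (forall n, simple_fun (s n)) /\ (forall x, s n x @[n --> \oo] --> f x).

Definition has_bochner_integral (D : set T) (f : T -> U) (v : U) : Prop :=
  exists s : nat -> T -> U,
    [/\ forall n, simple_fun (s n),
        forall n (u : U), u != 0 -> (mu (D `&` s n @^-1` [set u]) < +oo)%E,
        (\int[mu]_(x in D) `|f x - s n x|%:E)%E @[n --> \oo] --> (0 : \bar R)%E
      & simple_integral D (s n) @[n --> \oo] --> v].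

(* The default value [0] is only used when [f] is not Bochner integrable. *)
Definition bochner_integral (D : set T) (f : T -> U) : U :=
  xget 0 [set v | has_bochner_integral D f v].

Definition mean (f : T -> U) (B : set T) : U :=
  (fine (mu B))^-1 *: bochner_integral B f.

Definition in_Lr (r : R) (f : T -> U) : Prop :=
  strongly_measurable f /\ finite_norm mu r%:E (fun x => `|f x|).

Definition BMO_norm (Bs : set (set T)) (f : T -> U) : \bar R :=
  ereal_sup [set ((fine (mu B))^-1%:E * \int[mu]_(x in B) `|f x - mean f B|%:E)%E
            | B in Bs].

(* Integrability on balls is what gives a meaning to [mean f B]. *)
Definition in_BMO (Bs : set (set T)) (f : T -> U) : Prop :=
  [/\ strongly_measurable f,
      forall B, Bs B -> (\int[mu]_(x in B) `|f x|%:E < +oo)%E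
    & (BMO_norm Bs f < +oo)%E].

End Bochner.

Section BallBasis.
Context d (T : measurableType d) (R : realType).
Context (mu : {measure set T -> \bar R}) (Bs : set (set T)).

(* The set written B^* *)
Definition ball_star (B : set T) : set T :=
  \bigcup_(A in [set A | [/\ Bs A, (mu A <= 2%:E * mu B)%E & A `&` B !=set0]]) A.

(* A finite or infinite sequence of balls is encoded as a countable subfamily;
   the empty sequence is allowed. [A `+` B] is the symmetric difference. *)
Record ball_basis (K : R) : Prop := BallBasis {
  ball_measurable : forall B, Bs B -> measurable B;
  ball_measure : forall B, Bs B -> (0 < mu B < +oo)%E;
  ball_two_points : forall x y, exists B, [/\ Bs B, B x & B y];
  ball_approx : forall (E : set T) (eps : R), measurable E -> 0 < eps ->
    exists C : set (set T), [/\ C `<=` Bs, countable C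
      & (mu (E `+` \bigcup_(B in C) B) < eps%:E)%E];
  ball_hull : forall B, Bs B ->
    exists B', [/\ Bs B', ball_star B `<=` B' & (mu B' <= K%:E * mu B)%E] }.

Definition separable_basis : Prop :=
  forall C : set (set T), C `<=` Bs -> measurable (\bigcup_(B in C) B).

Definition doubling (eta : R) : Prop :=
  forall B, Bs B -> ball_star B <> setT ->
    exists B', [/\ Bs B', B `<` B' & (mu B' <= eta%:E * mu B)%E].

(* [mu A] is finite for balls [A], so [fine] loses nothing; the set is
   non-empty for a ball basis. *)
Definition vol_dist (x : T) (B : set T) : R :=
  inf [set fine (mu A) | A in [set A | Bs A /\ B `|` [set x] `<=` A]].

Definition modulus (omega : R -> R) : Prop :=
  [/\ forall t, 0 < t <= 1 -> 0 < omega t <= 1,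
      forall s t, 0 < s -> s <= t -> t <= 1 -> omega s <= omega t
    & forall s t, 0 < s -> 0 < t -> s + t <= 1 ->
        omega (s + t) <= omega s + omega t].

Definition modulus_norm (omega : R -> R) : \bar R :=
  (1 + \int[lebesgue_measure]_(t in (`]0%R, 1%R] : set R))
         (omega t * ln (1 / t) / t)%:E)%E.

Definition growth_fun (gam : R -> R) : Prop :=
  (forall t, 1 <= t -> 1 <= gam t) /\
  (forall s t, 1 <= s -> s <= t -> gam s <= gam t).

(* Only the values of [phi] on [Bs] matter. *)
Record omega_regular (omega gam : R -> R) (c1 c2 : R) (phi : set T -> T -> R)
    : Prop := OmegaRegular {
  reg_ge0 : forall B x, Bs B -> 0 <= phi B x;
  reg_integrable : forall B, Bs B -> mu.-integrable setT (EFin \o phi B);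
  reg_norm : forall B, Bs B -> 'N[mu]_1[EFin \o phi B]%E = 1%E;
  reg_growth : forall A B x, Bs A -> Bs B -> B `<=` A ->
    phi B x <= gam (fine (mu A) / fine (mu B)) * phi A x;
  reg_lower : forall B x, Bs B -> c1 * (\1_B x / fine (mu B)) <= phi B x;
  reg_upper : forall B x, Bs B ->
    phi B x <= c2 * (omega (fine (mu B) / vol_dist x B) * (vol_dist x B)^-1) }.

Definition complete_at (eta : R) (x : T) (Gx : set (set T)) : Prop :=
  [/\ Gx `<=` Bs, forall B, Gx B -> B x
    & forall A, Bs A -> A x ->
        exists A', [/\ Gx A', A `<=` A' & (mu A' <= eta%:E * mu A)%E]].

Definition maximal_fun (U : completeNormedModType R) (phi : set T -> T -> R)
    (G : T -> set (set T)) (f : T -> U) (x : T) : \bar R :=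
  ereal_sup [set (\int[mu]_y (`|f y| * phi B y)%:E)%E | B in G x].

End BallBasis.

(* Main.v *)
(* Write F = |f|, a_A = |mean of f over the ball A|, and let N exceed the BMO
   norm of f, so that F deviates from a_A by at most N on average over A.

   By doubling, A is the first term of an increasing chain of balls whose
   measures are bounded by L^k times that of A, so the means along the chain
   drift by O(N) per step.  The upper bound on phi_A then gives
   int |F - a_A| phi_A = O(N sum_k (k+1) omega(L^-k)), and the series is
   controlled by the logarithmic integral of omega.  Hence
   int F phi_A = a_A + O(N): up to O(N) the maximal function is the supremum of
   a_A over the balls A containing x, and the kernels play no further role.

   On a ball B, the balls that meet B and are at least as large contribute,
   uniformly in x, their supremum up to O(N).  For the smaller ones a stopping
   time argument of John-Nirenberg type shows that the set where some a_A
   exceeds a_B + k s, with s = O(N), has measure O(2^-k mu(B)); summing over k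
   bounds the oscillation of the maximal function on B. *)

Require Import Defs.
From mathcomp Require Import all_boot all_order all_algebra.
From mathcomp Require Import all_classical all_reals all_analysis.
From mathcomp Require Import measurable_realfun.
From mathcomp Require Import ring lra.

Import Order.TTheory GRing.Theory Num.Theory.
Import numFieldNormedType.Exports.

Local Open Scope classical_set_scope.
Local Open Scope ring_scope.

(** * Balls *)

(** Lets the later sections assume [1 <= K], by enlarging the constant of (B4). *)
Lemma ball_basis_weaken {d} {T : measurableType d} {R : realType}
    (mu : {measure set T -> \bar R}) (Bs : set (set T)) (K K' : R) :
  K <= K' -> ball_basis mu Bs K -> ball_basis mu Bs K'.
Proof.
move=> KK' bb; split; [exact: ball_measurable bb|exact: ball_measure bb|
  exact: ball_two_points bb|exact: ball_approx bb|].
move=> B BB; have [B' [BB' sB' leB']] := ball_hull bb BB.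
exists B'; split=> //; apply: (le_trans leB').
by apply: lee_wpmul2r; [exact: measure_ge0|rewrite lee_fin].
Qed.

Section Geometry.
Context {d : measure_display} {T : measurableType d} {R : realType}.
Context {mu : {measure set T -> \bar R}} {Bs : set (set T)} {K : R}.
Context (bb : ball_basis mu Bs K).
Local Notation m A := (fine (mu A)).

Lemma ball_muE A : Bs A -> mu A = (m A)%:E.
Proof.
move=> /(ball_measure bb)/andP[A0 Aoo]; rewrite fineK//.
by rewrite ge0_fin_numE// ltW.
Qed.

Lemma ball_mu_gt0 A : Bs A -> 0 < m A.
Proof.
by move=> BA; have /andP[+ _] := ball_measure bb BA; rewrite (ball_muE _ BA) lte_fin.
Qed.

Lemma ball_mu_le A A' : Bs A -> Bs A' -> A `<=` A' -> m A <= m A'.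
Proof.
move=> BA BA' AA'; rewrite -lee_fin -!ball_muE//.
by apply: le_measure => //; rewrite inE; exact: ball_measurable bb _ _.
Qed.

Lemma hull_exists B : Bs B -> exists B', [/\ Bs B', m B' <= K * m B
  & forall A, Bs A -> m A <= 2 * m B -> A `&` B !=set0 -> A `<=` B'].
Proof.
move=> BB; have [B' [BB' sB' leB']] := ball_hull bb BB.
exists B'; split=> //.
- by rewrite -lee_fin EFinM -!ball_muE.
- move=> A BA leA AB; apply: subset_trans sB'; apply: bigcup_sup.
  by split=> //; rewrite (ball_muE _ BA) (ball_muE _ BB) -EFinM lee_fin.
Qed.

(** A choice of the ball [B] of (B4), with measures read as reals. By [hull_exists] the default
    [set0] is never returned on a ball. *)
Definition hull (B : set T) : set T := xget set0
  [set B' | [/\ Bs B', m B' <= K * m B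
  & forall A, Bs A -> m A <= 2 * m B -> A `&` B !=set0 -> A `<=` B']].

Lemma hullP B : Bs B -> [/\ Bs (hull B), m (hull B) <= K * m B
  & forall A, Bs A -> m A <= 2 * m B -> A `&` B !=set0 -> A `<=` hull B].
Proof. by move=> /hull_exists; rewrite /hull => /(xgetPex set0). Qed.

Lemma ball_nonempty B : Bs B -> B !=set0.
Proof.
move=> BB; apply/set0P; apply/eqP => B0.
by have := ball_mu_gt0 _ BB; rewrite B0 measure0/= ltxx.
Qed.

Lemma sub_hull B : Bs B -> B `<=` hull B.
Proof.
move=> BB; have [_ _] := hullP _ BB; apply=> //.
- by have := ball_mu_gt0 _ BB; lra.
- by rewrite setIid; exact: ball_nonempty.
Qed.

(** The supremum of the measures is positive but may not be attained, so a ball above half of it is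
    taken. The factor 2 is that of [ball_star]: the hull of this ball absorbs every member of the
    family that meets it. *)
Lemma almost_max (F : set (set T)) (M : R) :
  F `<=` Bs -> F !=set0 -> (forall A, F A -> m A <= M) ->
  exists2 A0, F A0 & forall A, F A -> m A <= 2 * m A0.
Proof.
move=> FB [A FA] FM.
pose E := [set m A | A in F].
have hE : has_sup E by split; [exists (m A); exists A|exists M => _ [B FBB <-]; exact: FM].
have lesup C : F C -> m C <= sup E by move=> FC; apply: (ub_le_sup hE.2); exists C.
have s0 : 0 < sup E by apply: lt_le_trans (lesup _ FA); exact: ball_mu_gt0 (FB _ FA).
have [_ [A0 FA0 <-] lt0] := sup_adherent (divr_gt0 s0 (ltr0Sn R 1)) hE.
by exists A0 => // C /lesup; lra.
Qed.

(** Makes the infimum in [vol_dist] range over a nonempty set. A ball through [x] and a point of [B]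
    is compared with [B]; the hull of the larger of the two contains both. *)
Lemma common_ball x B : Bs B -> exists2 A, Bs A & B `|` [set x] `<=` A.
Proof.
move=> BB; have [y By] := ball_nonempty _ BB.
have [A [BA Ax Ay]] := ball_two_points bb x y.
have [mle|mlt] := leP (m A) (m B).
- have [Bh _ sub] := hullP _ BB; exists (hull B) => //.
  rewrite subUset; split; first exact: sub_hull.
  rewrite sub1set inE; apply: (sub A) => //; last by exists y.
  by have := ball_mu_gt0 _ BB; lra.
- have [Bh _ sub] := hullP _ BA; exists (hull A) => //.
  rewrite subUset; split; last by rewrite sub1set inE; exact: sub_hull.
  apply: sub => //; last by exists y.
  by have := ball_mu_gt0 _ BA; lra.
Qed.

Lemma vol_dist_ltP x B t : Bs B -> vol_dist mu Bs x B < t ->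
  exists A, [/\ Bs A, B `<=` A, A x & m A < t].
Proof.
move=> BB; rewrite /vol_dist; set E := [set fine (mu A) | A in _].
have hE : has_inf E.
  split; last by exists 0 => _ [A _ <-]; exact: fine_ge0.
  by have [A BA sA] := common_ball x _ BB; exists (m A); exists A.
move=> ltt; have e0 : 0 < t - inf E by rewrite subr_gt0.
have [_ [A [BA +] <-] lt0] := inf_adherent e0 hE.
rewrite subUset sub1set inE => -[sA Ax]; exists A; split=> //.
by move: lt0; rewrite addrCA subrr addr0.
Qed.

Lemma vol_dist_ge x B : Bs B -> m B <= vol_dist mu Bs x B.
Proof.
move=> BB; apply: lb_le_inf.
  by have [A BA sA] := common_ball x _ BB; exists (m A); exists A.
by move=> _ [A [BA +] <-]; rewrite subUset => -[sA _]; exact: ball_mu_le.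
Qed.

(* When no ball has measure comparable to [t], doubling forces the whole space
   to be a ball of measure [O(t)]. *)
Lemma ball_growth (eta : R) (A : set T) (t : R) :
  1 <= K -> 1 < eta -> doubling mu Bs eta -> Bs A -> m A < t ->
  exists A', [/\ Bs A', m A' <= (K + eta) * t, t <= m A' \/ A' = setT
    & forall A1, Bs A1 -> A `<=` A1 -> m A1 < t -> A1 `<=` A'].
Proof.
move=> K1 eta1 db BA lt_t.
have t0 : 0 < t by apply: lt_trans lt_t; exact: ball_mu_gt0.
pose F := [set A1 | [/\ Bs A1, A `<=` A1 & m A1 < t]].
(* All balls of [F] contain [A], hence meet each other, so the hull of a nearly largest one contains
   them all. *)
have [|||A0 [BA0 sA0 A0t] max0] := @almost_max F t.
- by move=> ? [].
- by exists A; split=> //; exact: subset_refl.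
- by move=> ? [_ _ /ltW].
have [BH mH subH] := hullP _ BA0.
have FH A1 : Bs A1 -> A `<=` A1 -> m A1 < t -> A1 `<=` hull A0.
  move=> BA1 sA1 A1t; apply: subH => //; first exact: max0.
  by have [y Ay] := ball_nonempty _ BA; exists y; split; [exact: sA1|exact: sA0].
have HKt : m (hull A0) <= K * t.
  by apply: (le_trans mH); rewrite ler_wpM2l// ?ltW//; lra.
have [tH|Ht] := leP t (m (hull A0)).
  exists (hull A0); split=> //; last by left.
  by apply: (le_trans HKt); rewrite ler_wpM2r// ?ltW//; lra.
(* Here [hull A0] has measure below [t]. If its star is the whole space, so is its hull, whose
   measure is at most [K * t]. *)
have [starT|starT] := pselect (ball_star mu Bs (hull A0) = setT).
  have [BHH mHH subHH] := hullP _ BH.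
  have HHT : hull (hull A0) = setT.
    apply/seteqP; split=> // x _.
    have : ball_star mu Bs (hull A0) x by rewrite starT.
    move=> [C [BC leC CH] Cx]; apply: (subHH C) => //.
    by move: leC; rewrite (ball_muE _ BC) (ball_muE _ BH) -EFinM lee_fin.
  exists (hull (hull A0)); split => //; last 2 first.
    by right.
    by move=> A1 _ _ _; rewrite HHT.
  apply: (le_trans mHH); rewrite mulrDl.
  have : K * m (hull A0) <= K * t by rewrite ler_wpM2l ?ltW//; lra.
  have : 0 <= eta * t by rewrite mulr_ge0// ltW//; lra.
  lra.
(* Otherwise doubling gives a strictly larger ball. Its measure is at least [t], since below [t] it
   would belong to [F] and lie in [hull A0]. *)
have [B' [BB' [sB' nsB'] mB']] := db _ BH starT.
have mB'' : m B' <= eta * m (hull A0) by rewrite -lee_fin EFinM -!ball_muE.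
have AB' : A `<=` B'.
  by apply: subset_trans sB'; apply: subset_trans sA0 _; exact: sub_hull.
exists B'; split => //.
- apply: (le_trans mB''); rewrite mulrDl.
  have : eta * m (hull A0) <= eta * t by rewrite ler_wpM2l ?ltW//; lra.
  have : 0 <= K * t by rewrite mulr_ge0// ltW//; lra.
  lra.
- left; rewrite leNgt; apply/negP => B't.
  by apply: nsB'; exact: FH.
- by move=> A1 *; apply: subset_trans sB'; exact: FH.
Qed.

End Geometry.

Arguments hull {d T R} mu Bs K B.

(** * Greedy selection of disjoint balls *)

Section Vitali.
Context {d : measure_display} {T : measurableType d} {R : realType}.
Context {mu : {measure set T -> \bar R}} {Bs : set (set T)} {K : R}.
Context (bb : ball_basis mu Bs K) (F : set (set T)) (D : set T).
Context (FBs : F `<=` Bs) (mD : measurable D) (Doo : (mu D < +oo)%E).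
Context (FD : forall A, F A -> A `<=` D).
Local Notation m A := (fine (mu A)).

Let avoid (l : seq (set T)) :=
  [set A | F A /\ forall C, C \in l -> A `&` C = set0].

(** When no member of [F] avoids [l], the default [set0] is picked, so that the selection never
    stops and stays disjoint. *)
Let greedy (l : seq (set T)) := xget set0
  [set A | avoid l A /\ forall C, avoid l C -> m C <= 2 * m A].

Let selected n := iter n (fun l => greedy l :: l) [::].

Let greedyP l : (avoid l (greedy l) \/ greedy l = set0) /\
  forall C, avoid l C -> m C <= 2 * m (greedy l).
Proof.
have [[A lA]|none] := pselect (avoid l !=set0); last first.
  split=> [|C lC]; last by exfalso; apply: none; exists C.
  by right; apply: xgetPN => A [lA _]; apply: none; exists A.
have [|||A0 lA0 A0max] := @almost_max _ _ _ _ _ _ bb (avoid l) (m D).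
- by move=> C [/FBs].
- by exists A.
- move=> C [FC _]; apply: fine_le.
  + by rewrite (ball_muE bb _ (FBs _ FC)).
  + by rewrite ge0_fin_numE.
  + apply: le_measure; rewrite ?inE//; last exact: FD.
    exact: ball_measurable bb _ (FBs _ FC).
- have : [set A | avoid l A /\ forall C, avoid l C -> m C <= 2 * m A] !=set0.
    by exists A0.
  by rewrite /greedy => /(xgetPex set0)[? ?]; split=> //; left.
Qed.

Let mem_selected n k : (k < n)%N -> greedy (selected k) \in selected n.
Proof.
elim: n => // n IH; rewrite ltnS leq_eqVlt => /predU1P[->|/IH kn].
  by rewrite /= mem_head.
by rewrite /= inE kn orbT.
Qed.

Let selectedP n C : C \in selected n ->
  exists2 k, (k < n)%N & C = greedy (selected k).
Proof.
elim: n => // n IH; rewrite /= inE => /predU1P[->|/IH[k kn ->]].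
  by exists n.
by exists k => //; exact: ltnW.
Qed.

(** If [A] met no selected ball of at least half its measure, it would remain a candidate at every
    stage, and every selected set would have measure at least [m A / 2]. Infinitely many disjoint
    ones do not fit into [D]. *)
Lemma vitali_disjoint_subfamily : exists A_ : nat -> set T,
  [/\ forall n, F (A_ n) \/ A_ n = set0, trivIset setT A_
    & forall A, F A -> exists n,
        [/\ F (A_ n), A `&` A_ n !=set0 & m A <= 2 * m (A_ n)]].
Proof.
pose A_ n := greedy (selected n).
have FA n : F (A_ n) \/ A_ n = set0.
  by have [[[? _]|?] _] := greedyP (selected n); [left|right].
have disj i j : (i < j)%N -> A_ j `&` A_ i = set0.
  move=> ij; have [[[_ av]|A0] _] := greedyP (selected j).
    by apply: av; exact: mem_selected.
  by rewrite [A_ j]A0 set0I.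
have tA : trivIset setT A_.
  move=> i j _ _ [x [Ai Aj]]; apply/eqP; case: ltngtP => // ij.
    by have := disj _ _ ij; rewrite -subset0 => /(_ x); case.
  by have := disj _ _ ij; rewrite -subset0 => /(_ x); case.
have mA n : measurable (A_ n).
  by case: (FA n) => [/FBs/(ball_measurable bb)//|->]; exact: measurable0.
exists A_; split=> // A FAA; apply: contrapT => none.
have avA n : avoid (selected n) A.
  elim/ltn_ind: n => n IH; split=> // C /selectedP[k kn ->].
  apply: contrapT => /eqP/set0P AAk; apply: none; exists k; split=> //.
    by case: (FA k) => // Ak0; move: AAk; rewrite [X in _ `&` X]Ak0 setI0 => -[].
  by apply: (greedyP (selected k)).2; exact: IH.
have le2 n : m A <= 2 * m (A_ n) by apply: (greedyP (selected n)).2; exact: avA.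
have muA n : mu (A_ n) = (m (A_ n))%:E.
  by case: (FA n) => [/FBs/(ball_muE bb)//|->]; rewrite measure0.
have mA0 := ball_mu_gt0 bb _ (FBs _ FAA).
have partial n : n%:R * (m A / 2) <= m D.
  rewrite -lee_fin fineK ?ge0_fin_numE//.
  apply: (@le_trans _ _ (\sum_(0 <= i <oo) mu (A_ i))%E).
    apply: le_trans (nneseries_lim_ge n _) => //.
    under eq_bigr do rewrite muA.
    rewrite sumEFin lee_fin mulr_natl -[in leLHS](subn0 n) -sumr_const_nat.
    by apply: ler_sum => i _; have := le2 i; lra.
  have <- : mu (\bigcup_i A_ i) = (\sum_(0 <= i <oo) mu (A_ i))%E.
    by rewrite measure_bigcup//; apply: eq_eseriesl => i; rewrite in_setT.
  apply: le_measure; rewrite ?inE//.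
    exact: bigcup_measurable.
  by move=> x [k _]; case: (FA k) => [/FD|->//]; exact.
have := partial (Num.bound (m D / (m A / 2))).
rewrite -ler_pdivlMr ?divr_gt0// leNgt archi_boundP// divr_ge0//.
Qed.

End Vitali.

(** * Mean oscillation *)

Section Oscillation.
Context {d : measure_display} {T : measurableType d} {R : realType}.
Context {mu : {measure set T -> \bar R}} {Bs : set (set T)} {K : R}.
Context (bb : ball_basis mu Bs K) (K1 : 1 <= K).
Context {F : T -> R} (mF : measurable_fun setT F) {a : set T -> R} {N : R}.
Context (N0 : 0 < N).
Local Notation m A := (fine (mu A)).
Context (osc : forall A, Bs A ->
  (\int[mu]_(x in A) `|F x - a A|%:E <= (N * m A)%:E)%E).

Lemma measurable_dist D c : measurable_fun D (fun x => `|F x - c|%:E).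
Proof.
apply/measurable_EFinP; apply: measurable_funTS.
by apply: measurableT_comp => //; exact: measurable_funB.
Qed.

Lemma integral_dist_le A c : Bs A ->
  (\int[mu]_(x in A) `|F x - c|%:E <= (m A * (N + `|a A - c|))%:E)%E.
Proof.
move=> BA; have mA := ball_measurable bb BA.
apply: (@le_trans _ _
    (\int[mu]_(x in A) (`|F x - a A|%:E + (cst `|a A - c|%:E) x)))%E.
  apply: ge0_le_integral => //.
  - exact: measurable_dist.
  - by apply: emeasurable_funD => //; exact: measurable_dist.
  - move=> x _ /=; rewrite -EFinD lee_fin.
    by rewrite (le_trans _ (ler_normD _ _))// addrA subrK.
rewrite ge0_integralD//; [|exact: measurable_dist|by move=> x _; rewrite lee_fin].
rewrite integral_cst// (ball_muE bb _ BA) mulrDr EFinD.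
by rewrite leeD ?[(_ * N)%R]mulrC ?osc// -EFinM mulrC.
Qed.

Lemma integral_dist_ge A c : Bs A ->
  (((`|a A - c| - N) * m A)%:E <= \int[mu]_(x in A) `|F x - c|%:E)%E.
Proof.
move=> BA; have mA := ball_measurable bb BA.
rewrite mulrBl EFinB leeBlDl// EFinM -(ball_muE bb _ BA) -integral_cst//.
apply: (@le_trans _ _ (\int[mu]_(x in A) (`|F x - a A|%:E + `|F x - c|%:E))%E).
  apply: ge0_le_integral => //.
  - by move=> x _; rewrite lee_fin.
  - by apply: emeasurable_funD => //; exact: measurable_dist.
  - move=> x _ /=; rewrite -EFinD lee_fin (distrC (F x) (a A)).
    exact: ler_distD.
rewrite ge0_integralD//; [|exact: measurable_dist..].
by rewrite leeD2r// osc.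
Qed.

(** Average the triangle inequality through [F x] over [A]: the deviation from [a A] costs [N], and
    the deviation from [a A'], integrated over all of [A'], costs [C * N]. *)
Lemma mean_dist_le A A' C : Bs A -> Bs A' -> A `<=` A' -> m A' <= C * m A ->
  `|a A - a A'| <= N * (1 + C).
Proof.
move=> BA BA' AA' leC.
have mA := ball_measurable bb BA; have mA' := ball_measurable bb BA'.
rewrite -(ler_pM2r (ball_mu_gt0 bb _ BA)) mulrDr mulr1 mulrDl -lerBlDl -mulrBl.
rewrite -lee_fin; apply: (le_trans (integral_dist_ge _ _ BA)).
apply: (@le_trans _ _ (\int[mu]_(x in A') `|F x - a A'|%:E)%E).
  by apply: ge0_subset_integral => //; exact: measurable_dist.
apply: (le_trans (osc _ BA')); rewrite lee_fin -mulrA ler_wpM2l// ltW//.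
Qed.

Lemma mean_dist_hull A : Bs A -> `|a A - a (hull mu Bs K A)| <= N * (1 + K).
Proof.
move=> BA; have [BH mH _] := hullP bb _ BA.
by apply: mean_dist_le => //; exact: sub_hull.
Qed.

(** Both balls lie in [hull A], of measure at most [K * C * m B]. Comparing each with it costs
    [N * (1 + K)] for [A] and [N * (1 + K * C)] for [B]. *)
Lemma mean_dist_comparable A B C : Bs A -> Bs B -> B `&` A !=set0 ->
  m B <= m A -> m A <= C * m B -> `|a A - a B| <= N * (2 + K + K * C).
Proof.
move=> BA BB AB BleA AleC.
have [BH mH sub] := hullP bb _ BA.
have BH' : B `<=` hull mu Bs K A.
  by apply: sub => //; have := ball_mu_gt0 bb _ BA; lra.
have h1 := mean_dist_hull _ BA.
have : `|a B - a (hull mu Bs K A)| <= N * (1 + K * C).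
  apply: mean_dist_le => //; apply: (le_trans mH).
  by rewrite -mulrA ler_wpM2l// (le_trans ler01).
have := ler_distD (a (hull mu Bs K A)) (a A) (a B).
rewrite (distrC (a (hull mu Bs K A)) (a B)).
have -> : N * (2 + K + K * C) = N * (1 + K) + N * (1 + K * C) by ring.
lra.
Qed.

End Oscillation.

(* [jn_gap] makes the stopping balls occupy at most [1 / (2 * K)] of the mass of
   the given ball; [jn_step] also pays for passing to their hulls. *)
Definition jn_gap {R : realType} (K eta : R) :=
  3 + K + 2 * K * (K + eta) + 2 * K ^+ 2 * (2 + K).

Definition jn_step {R : realType} (K eta : R) :=
  jn_gap K eta + 2 + 2 * (K + eta) + K.

(** A level set, at height [k * s] above [a B], of the maximal function of the means over balls no
    larger than [B]. As a union of balls it is measurable by separability; it may stick out of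
    [B]. *)
Definition jn_set {d} {T : measurableType d} {R : realType}
    (mu : {measure set T -> \bar R}) (Bs : set (set T)) (a : set T -> R)
    (s : R) (k : nat) (B : set T) : set T :=
  \bigcup_(A in [set A | [/\ Bs A, fine (mu A) <= fine (mu B),
                         A `&` B !=set0 & a B + k%:R * s < a A]]) A.

(** * Exponential decay of the level sets of the means *)

Section JohnNirenberg.
Context {d : measure_display} {T : measurableType d} {R : realType}.
Context {mu : {measure set T -> \bar R}} {Bs : set (set T)} {K eta : R}.
Context (bb : ball_basis mu Bs K) (sep : separable_basis Bs).
Context (db : doubling mu Bs eta) (K1 : 1 <= K) (eta1 : 1 < eta).
Context {F : T -> R} (mF : measurable_fun setT F) {a : set T -> R} {N : R}.
Context (N0 : 0 < N).
Local Notation m A := (fine (mu A)).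
Context (osc : forall A, Bs A ->
  (\int[mu]_(x in A) `|F x - a A|%:E <= (N * m A)%:E)%E).
Local Notation hull := (hull mu Bs K).

Local Notation jn_gap := (jn_gap K eta).
Local Notation jn_step := (jn_step K eta).
Local Notation jn_set := (jn_set mu Bs a (jn_step * N)).

Let K0 : 0 <= K. Proof. exact: le_trans ler01 K1. Qed.

(** The second bound ensures that a ball comparable to [B] does not rise above the gap, as
    [stopping_ball] requires; the third makes the selected balls small in total in
    [jn_set_decay]. *)
Let jn_gap_ge : [/\ 0 <= jn_gap, 2 + K + K * (2 * (K + eta)) <= jn_gap
  & 2 * K ^+ 2 * (2 + K) <= jn_gap - 1].
Proof.
have k0 := K0; have k1 := K1; have e1 := eta1.
have h1 : 0 <= K * (K + eta) by rewrite mulr_ge0//; lra.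
have h2 : 0 <= K ^+ 2 * (2 + K) by rewrite mulr_ge0 ?exprn_ge0//; lra.
by rewrite /jn_gap; split; lra.
Qed.

Let above (t : R) (B : set T) :=
  [set A | [/\ Bs A, m A <= m B, A `&` B !=set0 & a B + t < a A]].

(** Grow [A], at least doubling its measure each time, while the mean stays above the gap. This ends
    before measure [m B] is reached. On the last ball the mean is close both to that of the next
    ball, which is below the gap, and to that of the hull; the two errors make up
    [jn_step - jn_gap]. *)
Lemma stopping_ball A B : Bs B -> above (jn_gap * N) B A ->
  exists A0, [/\ above (jn_gap * N) B A0, A `<=` A0
    & a (hull A0) <= a B + jn_step * N].
Proof.
move=> BB; have [g0 g1 _] := jn_gap_ge; have k0 := K0; have k1 := K1; have e1 := eta1.
have mB := ball_mu_gt0 bb _ BB.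
(* Induction on the number of doublings that remain available; none remains when [n] is 0, because
   [m A <= m B]. *)
suff H n : forall A, m B < 2 ^+ n * m A -> above (jn_gap * N) B A ->
    exists A0, [/\ above (jn_gap * N) B A0, A `<=` A0
      & a (hull A0) <= a B + jn_step * N].
  move=> FA; have [BA _ _ _] := FA; have mA := ball_mu_gt0 bb _ BA.
  apply: (H (Num.bound (m B / m A))) => //.
  rewrite -ltr_pdivrMr//; apply: (lt_le_trans (archi_boundP _)).
    by rewrite divr_ge0// ltW.
  by rewrite -natrX ler_nat ltnW// ltn_expl.
elim: n => [|n IH] {}A ltA [BA AleB AB gapA].
  by move: ltA; rewrite expr0 mul1r ltNge AleB.
have mA := ball_mu_gt0 bb _ BA.
have [|A' [BA' leA' geA' subA']] := @ball_growth _ _ _ _ _ _ bb eta A (2 * m A) K1 eta1 db BA.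
  lra.
have AA' : A `<=` A' by apply: subA' => //; lra.
have [aA'|aA'] := leP (a A') (a B + jn_gap * N).
  exists A; split => //.
  have h1 : `|a A - a (hull A)| <= N * (1 + K) by exact: (mean_dist_hull bb mF N0 osc).
  have h2 : `|a A - a A'| <= N * (1 + 2 * (K + eta)).
    by apply: (mean_dist_le bb mF N0 osc) => //; rewrite (le_trans leA')// mulrA (mulrC 2).
  have -> : jn_step * N = jn_gap * N + (N * (1 + K) + N * (1 + 2 * (K + eta))).
    by rewrite /jn_step; ring.
  move: h1 h2; rewrite !ler_norml => /andP[? ?] /andP[? ?]; lra.
have A'B : B `&` A' !=set0.
  by have [y [Ay By]] := AB; exists y; split=> //; exact: AA'.
(* A ball [A'] of measure at least [m B] would be comparable to [B], with ratio at most
   [2 * (K + eta)], so its mean could not exceed [a B] by more than the gap. *)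
have ltA'B : m A' < m B.
  rewrite ltNge; apply/negP => BleA'.
  have : `|a A' - a B| <= N * (2 + K + K * (2 * (K + eta))).
    apply: (mean_dist_comparable bb K1 mF N0 osc) => //; apply: (le_trans leA').
    rewrite mulrA (mulrC _ 2) ler_wpM2l// mulr_ge0//; lra.
  have : N * (2 + K + K * (2 * (K + eta))) <= jn_gap * N.
    by rewrite mulrC ler_wpM2r// ltW.
  by rewrite ler_norml => ? /andP[? ?]; lra.
have {}geA' : 2 * m A <= m A'.
  case: geA' => // A'T; move: ltA'B; rewrite ltNge => /negP; case.
  by apply: (ball_mu_le bb) => //; rewrite A'T.
have [||A0 [FA0 A'A0 h]] := IH A'.
- apply: (lt_le_trans ltA); rewrite exprSr -mulrA ler_wpM2l//.
- by split=> //; [exact: ltW|rewrite setIC].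
- by exists A0; split=> //; exact: subset_trans A'A0.
Qed.

Lemma measurable_jn_set k B : measurable (jn_set k B).
Proof. by apply: sep => A []. Qed.

(** Induction on [k]. The balls of level [k.+1] lie in the hulls of disjoint stopping balls. The
    means over these hulls are at most one step above [a B], so inside them only level [k] is left.
    Passing to hulls costs a factor [K], and the stopping balls have total measure at most
    [m B / (2 * K)]; hence the factor 1/2 per level. *)
Lemma jn_set_decay k B : Bs B -> (mu (jn_set k B) <= (K * m B / 2 ^+ k)%:E)%E.
Proof.
have [g0 g1 g2] := jn_gap_ge; have k0 := K0; have k1 := K1; have e1 := eta1.
elim: k B => [|k IH] B BB; have mB := ball_mu_gt0 bb _ BB;
    have [BH mH subH] := hullP bb _ BB.
  rewrite expr0 divr1; apply: (@le_trans _ _ (mu (hull B))).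
    apply: le_measure; rewrite ?inE; [exact: measurable_jn_set|exact: (ball_measurable bb)|].
    move=> x [A [BA AleB AB _] Ax]; apply: (subH A) => //; lra.
  by rewrite (ball_muE bb _ BH) lee_fin.
pose Stop := [set A | above (jn_gap * N) B A /\ a (hull A) <= a B + jn_step * N].
have mHB : measurable (hull B) by exact: (ball_measurable bb).
have [||||A_ [FA tA covA]] := @vitali_disjoint_subfamily _ _ _ _ _ _ bb Stop (hull B).
- by move=> A [[]].
- exact: mHB.
- by rewrite (ball_muE bb _ BH) ltry.
- move=> A [[BA AleB AB _] _]; apply: subH => //; lra.
have mA n : measurable (A_ n).
  by case: (FA n) => [[[+ _ _ _] _]|->//]; exact: (ball_measurable bb).
have AH : \bigcup_n A_ n `<=` hull B.
  move=> x [n _]; case: (FA n) => [[[BA AleB AB _] _]|->//].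
  by apply: subH => //; lra.
pose u := mu (\bigcup_n A_ n).
have mU : measurable (\bigcup_n A_ n) by exact: bigcup_measurable.
have ufin : u \is a fin_num.
  rewrite /u ge0_fin_numE//; apply: (@le_lt_trans _ _ (mu (hull B))).
    by apply: le_measure; rewrite ?inE.
  by rewrite (ball_muE bb _ BH) ltry.
have usum : u = (\sum_(0 <= n <oo) mu (A_ n))%E.
  by rewrite /u measure_bigcup//; apply: eq_eseriesl => i; rewrite in_setT.
(* On each selected ball the average deviation of [F] from [a B] is at least [(jn_gap - 1) * N],
   while its integral over [hull B] is at most [K * m B * (N * (2 + K))]. *)
have small : 2 * K * fine u <= m B.
  have : (((jn_gap - 1) * N)%:E * u <= (K * m B * (N * (2 + K)))%:E)%E.
    apply: (@le_trans _ _ (\int[mu]_(x in hull B) `|F x - a B|%:E)%E); last first.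
      apply: (le_trans (integral_dist_le bb mF osc _ _ BH)).
      rewrite lee_fin; apply: ler_pM => //.
      - by rewrite addr_ge0// ltW.
      - have : `|a B - a (hull B)| <= N * (1 + K) by exact: (mean_dist_hull bb mF N0 osc).
        by rewrite distrC; lra.
    apply: (@le_trans _ _ (\int[mu]_(x in \bigcup_n A_ n) `|F x - a B|%:E)%E); last first.
      by apply: ge0_subset_integral => //; exact: measurable_dist.
    rewrite ge0_integral_bigcup//; last exact: measurable_dist.
    rewrite usum -nneseriesZl//; apply: lee_nneseries => [i _ _|i _].
      by rewrite mule_ge0// lee_fin mulr_ge0 ?(ltW N0)//; nra.
    case: (FA i) => [[[BA _ _ lta] _]|->]; last by rewrite measure0 mule0 integral_ge0.
    apply: le_trans (integral_dist_ge bb mF osc _ _ BA).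
    rewrite (ball_muE bb _ BA) -EFinM lee_fin ler_wpM2r//.
    by have := ler_norm (a (A_ i) - a B); lra.
  rewrite -(fineK ufin) -EFinM lee_fin => h.
  have kk : 0 < K * (2 + K) * N by rewrite !mulr_gt0//; lra.
  rewrite -(ler_pM2l kk).
  have : 2 * K ^+ 2 * (2 + K) * (N * fine u) <= (jn_gap - 1) * (N * fine u).
    by rewrite ler_wpM2r// mulr_ge0 ?(ltW N0)// fine_ge0// measure_ge0.
  nra.
(* Indices at which the selection returned the filler [set0] contribute nothing. *)
pose Z n := if pselect (Stop (A_ n)) then jn_set k (hull (A_ n)) else set0.
have mZ n : measurable (Z n).
  by rewrite /Z; case: pselect => //= ?; exact: measurable_jn_set.
have cZ : jn_set k.+1 B `<=` \bigcup_n Z n.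
  move=> x [A [BA AleB AB lta] Ax].
  have FA1 : above (jn_gap * N) B A.
    split=> //; apply: le_lt_trans lta; rewrite lerD2l.
    rewrite -[k.+1%:R]natr1 (mulrDl k%:R) mul1r.
    have : 0 <= k%:R * (jn_step * N).
      by rewrite !mulr_ge0 ?(ltW N0)//; rewrite /jn_step; lra.
    have : jn_gap * N <= jn_step * N by rewrite ler_pM2r// /jn_step; lra.
    lra.
  have [A0 [FA0 sA0 leA0]] := stopping_ball _ _ BB FA1.
  have [n [Sn A0n len]] := covA A0 (conj FA0 leA0).
  exists n => //; rewrite /Z; case: pselect => //= ?.
  have [[BAn _ _ _] lean] := Sn; have [BA0 _ _ _] := FA0.
  have [BHn _ subHn] := hullP bb _ BAn.
  (* The stopping ball [A0] around [A] meets [A_ n] and has at most twice its measure, so the hull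
     swallows it. *)
  have AHn : A `<=` hull (A_ n) by apply: subset_trans (subHn _ BA0 len A0n).
  exists A => //; split=> //.
  - exact: (ball_mu_le bb).
  - by exists x; split=> //; exact: AHn.
  - apply: le_lt_trans lta; rewrite -[k.+1%:R]natr1 (mulrDl k%:R) mul1r; lra.
have leZ n : (mu (Z n) <= (K / 2 ^+ k * K)%:E * mu (A_ n))%E.
  rewrite /Z; case: pselect => /= [[[BAn _ _ _] _]|_]; last first.
    by rewrite measure0 mule_ge0// lee_fin !mulr_ge0.
  have [BHn mHn _] := hullP bb _ BAn.
  apply: (le_trans (IH _ BHn)); rewrite (ball_muE bb _ BAn) -EFinM lee_fin.
  by rewrite -[leRHS]mulrA [leLHS]mulrAC ler_wpM2l// divr_ge0.
apply: (@le_trans _ _ (\sum_(0 <= n <oo) mu (Z n))%E).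
  by apply: measure_sigma_subadditive => //; exact: measurable_jn_set.
apply: (@le_trans _ _ ((K / 2 ^+ k * K)%:E * u)%E).
  by rewrite usum -nneseriesZl//; apply: lee_nneseries.
rewrite -(fineK ufin) -EFinM lee_fin exprS invfM.
have -> : K / 2 ^+ k * K * fine u = (K / 2 ^+ k) * (K * fine u) by ring.
have -> : K * m B * (2^-1 * (2 ^+ k)^-1) = (K / 2 ^+ k) * (m B / 2) by ring.
rewrite ler_wpM2l ?divr_ge0//; lra.
Qed.

End JohnNirenberg.

(** * Kernels *)

Section Modulus.
Context {R : realType} {omega : R -> R} (om : modulus omega).

Let om_le s t : 0 < s -> s <= t -> t <= 1 -> omega s <= omega t.
Proof. by case: om => _ + _; exact. Qed.

Let om_bnd t : 0 < t <= 1 -> 0 < omega t <= 1.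
Proof. by case: om => + _ _; exact. Qed.

(* The library has measurability of globally monotone functions only, hence the
   extension of [omega] outside [(0, 1]]. *)
Let om_ext t := if t <= 0 then 0 else if t <= 1 then omega t else 1.

Let om_ext_homo : {homo om_ext : s t / s <= t}.
Proof.
move=> s t st; rewrite /om_ext; case: (leP s 0) => s0.
  case: (leP t 0) => // t0; case: (leP t 1) => // t1.
  by have /andP[/ltW] := om_bnd t ltac:(by rewrite t0).
rewrite (leNgt t 0) (lt_le_trans s0 st)/=; case: (leP s 1) => s1.
  case: (leP t 1) => t1; first exact: om_le.
  by have /andP[_] := om_bnd s ltac:(by rewrite s0).
by rewrite (leNgt t 1) (lt_le_trans s1 st).
Qed.

(** The integrand of [modulus_norm] on (0, 1], with 1/t written as [expR (- ln t)] so that it is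
    visibly measurable on the whole line. *)
Let kernel t := om_ext t * (- ln t) * expR (- ln t).

Let measurable_kernel : measurable_fun setT (fun t : R => (kernel t)%:E).
Proof.
apply/measurable_EFinP.
have mln : measurable_fun setT (fun t : R => - ln t).
  by apply: measurableT_comp => //; exact: measurable_ln.
apply: measurable_funM; first apply: measurable_funM => //.
- exact: nondecreasing_measurable.
- by apply: measurableT_comp => //; exact: measurable_expR.
Qed.

Let kernel_in01 t : 0 < t <= 1 -> kernel t = omega t * ln (1 / t) / t.
Proof.
move=> /andP[t0 t1]; rewrite /kernel /om_ext (leNgt t 0) t0 t1/=.
by rewrite div1r -lnV ?posrE// lnK ?posrE ?invr_gt0.
Qed.

Let kernel_ge0 t : 0 < t <= 1 -> 0 <= kernel t.
Proof.
move=> t01; have /andP[t0 t1] := t01; rewrite kernel_in01// !mulr_ge0//.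
- by have /andP[/ltW] := om_bnd t t01.
- by rewrite ln_ge0// ler_pdivlMr// mul1r.
- by rewrite invr_ge0 ltW.
Qed.

Context {W L : R} (L1 : 1 < L) (normW : modulus_norm omega = W%:E).

Let L0 : 0 < L. Proof. exact: lt_trans ltr01 L1. Qed.

Let mass := ln L * (1 - L^-1).

Let mass_gt0 : 0 < mass.
Proof. by rewrite mulr_gt0 ?ln_gt0// subr_gt0 invf_lt1. Qed.

(** The pieces start below [L^-1], where the logarithm is already at least [ln L]; near 1 it
    vanishes and gives no lower bound. *)
Let I k : set R := `]L ^- k.+2, L ^- k.+1]%classic.

Let I01 k t : I k t -> 0 < t <= 1.
Proof.
rewrite /I/= in_itv/= => /andP[lt tl].
rewrite (lt_trans _ lt) ?invr_gt0 ?exprn_gt0//=.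
by rewrite (le_trans tl)// invf_le1 ?exprn_gt0// exprn_ege1// ltW.
Qed.

(** On [I k] each factor is bounded below by its value at an endpoint: [omega] at the left one, the
    logarithm and 1/t at the right one. The length of [I k] cancels [L ^+ k.+1] and leaves
    [1 - L^-1]. *)
Let integral_piece k : ((k.+1%:R * omega (L ^- k.+2) * mass)%:E
  <= \int[lebesgue_measure]_(t in I k) (kernel t)%:E)%E.
Proof.
have Lk n : 0 < L ^+ n by rewrite exprn_gt0.
have mI : measurable (I k) by exact: measurable_itv.
have omk : 0 < omega (L ^- k.+2) <= 1.
  apply: om_bnd; rewrite invr_gt0 Lk invf_le1//.
  by rewrite exprn_ege1// ltW.
have ltk : L ^- k.+2 < L ^- k.+1.
  by rewrite ltf_pV2 ?posrE// [L ^+ k.+2]exprS ltr_pMl.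
pose v := k.+1%:R * omega (L ^- k.+2) * ln L * L ^+ k.+1.
have -> : ((k.+1%:R * omega (L ^- k.+2) * mass)%:E =
    \int[lebesgue_measure]_(t in I k) cst v%:E t)%E.
  have muI : lebesgue_measure (I k) = (L ^- k.+1 - L ^- k.+2)%:E.
    by rewrite /I lebesgue_measure_itv/= lte_fin ltk -EFinD.
  rewrite integral_cst//= [X in (_ * X)%E]muI -EFinM.
  congr EFin; rewrite /v /mass -!mulrA; congr (_ * (_ * (_ * _))).
  by rewrite mulrBr mulfV ?gt_eqF// [L ^+ k.+2]exprSr invfM mulrA mulfV ?gt_eqF// mul1r.
apply: ge0_le_integral => //.
- move=> t _ /=; rewrite lee_fin /v !mulr_ge0//; [|by rewrite ln_ge0// ltW|exact: ltW].
  by case/andP: omk => /ltW.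
- exact: measurable_funTS.
- move=> t It; have t01 := I01 _ _ It; have /andP[t0 t1] := t01.
  move: It; rewrite /I/= in_itv/= => /andP[lt tl].
  have Lt : L ^+ k.+1 <= t^-1 by rewrite -[leLHS]invrK lef_pV2 ?posrE// invr_gt0.
  rewrite lee_fin kernel_in01// /v; apply: ler_pM => //.
  + rewrite !mulr_ge0// ?ln_ge0 ?(ltW L1)//.
    by case/andP: omk => /ltW.
  + exact: ltW.
  + rewrite [k.+1%:R * _]mulrC -mulrA; apply: ler_pM => //.
    * by case/andP: omk => /ltW.
    * by rewrite mulr_ge0// ln_ge0// ltW.
    * by apply: om_le => //; [rewrite invr_gt0|exact: ltW].
    * by rewrite mulr_natl -lnXn// div1r ler_ln ?posrE ?invr_gt0.
Qed.

(** Terms 0 and 1 are at most 1 and 2, since [omega <= 1]. For the others [k + 3 <= 3 * (k + 1)],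
    and the pieces [I k] are disjoint in (0, 1]. *)
Lemma modulus_series_le : (\sum_(0 <= k <oo) (k.+1%:R * omega (L ^- k))%:E
  <= (3 + 3 * (W / (ln L * (1 - L^-1))))%:E)%E.
Proof.
rewrite -/mass.
have Lk n : 0 < L ^- n <= 1.
  by rewrite invr_gt0 exprn_gt0//= invf_le1 ?exprn_gt0// exprn_ege1// ltW.
have om0 n : 0 <= omega (L ^- n) by have /andP[/ltW] := om_bnd _ (Lk n).
have om1 n : omega (L ^- n) <= 1 by have /andP[] := om_bnd _ (Lk n).
have tail : (\sum_(0 <= k <oo) (k.+1%:R * omega (L ^- k.+2) * mass)%:E <= W%:E)%E.
  apply: (@le_trans _ _
      (\sum_(0 <= k <oo) \int[lebesgue_measure]_(t in I k) (kernel t)%:E)%E).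
    apply: lee_nneseries => [k _ _|k _]; last exact: integral_piece.
    by rewrite lee_fin (mulr_ge0 _ (ltW mass_gt0))// mulr_ge0.
  have sI : \bigcup_k I k `<=` `]0, 1].
    by move=> t [k _ /I01]; rewrite /= in_itv.
  have tI : trivIset setT I.
    apply: ltn_trivIset => j i ij; apply/seteqP; split=> // t [].
    rewrite /I/= !in_itv/= => /andP[ti _] /andP[_ tj].
    have := lt_le_trans ti tj; rewrite ltf_pV2 ?posrE ?exprn_gt0//.
    by rewrite ltr_eXn2l// ltnS ltnNge ij.
  rewrite -ge0_integral_bigcup//; [|by move=> k; exact: measurable_itv
    |exact: measurable_funTS
    |by move=> t [k _ /I01 t01]; rewrite lee_fin kernel_ge0].
  apply: (@le_trans _ _ (\int[lebesgue_measure]_(t in (`]0%R, 1%R] : set R)) (kernel t)%:E)%E).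
    apply: ge0_subset_integral => //.
    - by apply: bigcup_measurable => k _; exact: measurable_itv.
    - exact: measurable_funTS.
  rewrite -normW /modulus_norm.
  under eq_integral => t.
    by rewrite inE/= in_itv/= => t01; rewrite kernel_in01//; over.
  by rewrite leeDr.
rewrite (nneseries_split 0 2) => [|k _]; last by rewrite lee_fin mulr_ge0.
rewrite EFinD; apply: leeD.
  rewrite big_nat_recl//= big_nat1 -EFinD lee_fin.
  by have := om1 0%N; have := om1 1%N; lra.
rewrite -nneseries_addn => [|k]; last by rewrite lee_fin mulr_ge0.
apply: (@le_trans _ _ ((3 / mass)%:E *
    \sum_(0 <= k <oo) (k.+1%:R * omega (L ^- k.+2) * mass)%:E)%E); last first.
  have -> : (3 * (W / mass))%:E = ((3 / mass)%:E * W%:E)%E.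
    by rewrite -EFinM; congr EFin; ring.
  by apply: lee_wpmul2l => //; rewrite lee_fin divr_ge0// ltW.
rewrite -nneseriesZl => [|k _]; last by rewrite lee_fin (mulr_ge0 _ (ltW mass_gt0))// mulr_ge0.
apply: lee_nneseries => [k _ _|k _]; first by rewrite lee_fin mulr_ge0.
rewrite -EFinM lee_fin (_ : (k + 2)%N = k.+2); last by rewrite addn2.
have -> : 3 / mass * (k.+1%:R * omega (L ^- k.+2) * mass) =
    3 * k.+1%:R * omega (L ^- k.+2) by field; rewrite gt_eqF.
rewrite ler_wpM2r// -natrM ler_nat mulnS -addn3 addnC leq_add2l.
exact: leq_pmull.
Qed.

End Modulus.

(** [L] is the ratio of the measure thresholds along the chain of balls, [C] bounds the ratio of
    consecutive measures, and the last factor bounds the series of [modulus_series_le]. *)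
Definition kernel_const {R : realType} (K eta c2 W : R) : R :=
  let L := K + eta + 1 in let C := (K + eta) * L in
  c2 * (C * (2 + C) * (3 + 3 * (W / (ln L * (1 - L^-1))))).

(** * Averaging against the kernel of a ball *)

Section KernelMean.
Context {d : measure_display} {T : measurableType d} {R : realType}.
Context {mu : {measure set T -> \bar R}} {Bs : set (set T)} {K eta : R}.
Context (bb : ball_basis mu Bs K).
Context (db : doubling mu Bs eta) (K1 : 1 <= K) (eta1 : 1 < eta).
Context {F : T -> R} (mF : measurable_fun setT F) {a : set T -> R} {N : R}.
Context (N0 : 0 < N).
Local Notation m A := (fine (mu A)).
Context (osc : forall A, Bs A ->
  (\int[mu]_(x in A) `|F x - a A|%:E <= (N * m A)%:E)%E).
Context {omega : R -> R} {W : R}.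
Context (om : modulus omega) (normW : modulus_norm omega = W%:E).
Context {A : set T} (BA : Bs A) {phi : T -> R} {c2 : R} (c20 : 0 < c2).
Context (phi0 : forall x, 0 <= phi x) (mphi : measurable_fun setT phi).
Context (phi_le : forall x, phi x <=
  c2 * (omega (m A / vol_dist mu Bs x A) * (vol_dist mu Bs x A)^-1)).

Local Notation L := (K + eta + 1).
Local Notation C := ((K + eta) * L).
Local Notation kernel_const := (kernel_const K eta c2 W).

Let mA0 : 0 < m A. Proof. exact: ball_mu_gt0 bb _ BA. Qed.

Let Keta : 2 < K + eta. Proof. by have := K1; have := eta1; lra. Qed.

Let C0 : 0 <= C. Proof. by rewrite mulr_ge0//; have := Keta; lra. Qed.

Let Lk k : 1 <= L ^+ k. Proof. by rewrite exprn_ege1//; have := Keta; lra. Qed.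

Let Lk0 k : 0 < L ^+ k. Proof. exact: lt_le_trans ltr01 (Lk k). Qed.

(* [B k] contains every ball of measure below [L ^+ k.+1 * m A] around [A]. *)
Let B k := xget set0 [set A' | [/\ Bs A', m A' <= (K + eta) * (L ^+ k.+1 * m A),
  L ^+ k.+1 * m A <= m A' \/ A' = setT
  & forall A1, Bs A1 -> A `<=` A1 -> m A1 < L ^+ k.+1 * m A -> A1 `<=` A']].

Let BP k : [/\ Bs (B k), m (B k) <= (K + eta) * (L ^+ k.+1 * m A),
  L ^+ k.+1 * m A <= m (B k) \/ B k = setT
  & forall A1, Bs A1 -> A `<=` A1 -> m A1 < L ^+ k.+1 * m A -> A1 `<=` B k].
Proof.
rewrite /B; apply: (xgetPex set0 (ball_growth bb _ _ _ K1 eta1 db BA _)).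
by rewrite ltr_pMl// exprn_egt1//; have := Keta; lra.
Qed.

Let subAB k : A `<=` B k.
Proof.
have [_ _ _] := BP k; apply=> //.
by rewrite ltr_pMl// exprn_egt1//; have := Keta; lra.
Qed.

(** [L] exceeds [K + eta] precisely so that [B k] falls below the threshold of [B k.+1]. *)
Let subB k : B k `<=` B k.+1.
Proof.
have [Bk leB _ _] := BP k; have [_ _ _ ] := BP k.+1; apply => //.
apply: (le_lt_trans leB); rewrite mulrA ltr_pM2r// [L ^+ k.+2]exprS.
by rewrite ltr_pM2r// ltrDl.
Qed.

Let ratioB k : m (B k.+1) <= C * m (B k).
Proof.
have [Bk _ geB _] := BP k; have [Bk1 leB _ _] := BP k.+1.
case: geB => [geB|BT].
  apply: (le_trans leB); rewrite [L ^+ k.+2]exprS -!mulrA.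
  have K0 : 0 <= K + eta by have := Keta; lra.
  by rewrite ler_wpM2l// ler_wpM2l// addr_ge0.
have mBk := ball_mu_gt0 bb _ Bk.
apply: (@le_trans _ _ (m (B k))).
  by apply: (ball_mu_le bb) => //; rewrite BT; exact: subsetT.
apply: ler_peMl; first exact: ltW.
by rewrite mulr_ege1//; have := Keta; lra.
Qed.

Let chain_mean k : `|a (B k) - a A| <= k.+1%:R * (N * (1 + C)).
Proof.
elim: k => [|k IH].
  have [B0 leB _ _] := BP 0; rewrite mul1r distrC.
  by apply: (mean_dist_le bb mF N0 osc) => //; rewrite -mulrA -[X in X * m A]expr1.
have [Bk _ _ _] := BP k; have [Bk1 _ _ _] := BP k.+1.
have h : `|a (B k) - a (B k.+1)| <= N * (1 + C).
  exact: (mean_dist_le bb mF N0 osc).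
apply: (le_trans (ler_distD (a (B k)) _ _)); rewrite distrC -[k.+2%:R]natr1.
by rewrite (mulrDl k.+1%:R) mul1r addrC lerD.
Qed.

Let piece k : (\int[mu]_(x in B k) `|F x - a A|%:E <=
  ((K + eta) * (L ^+ k.+1 * m A) * (k.+1%:R * (N * (2 + C))))%:E)%E.
Proof.
have [Bk leB _ _] := BP k.
apply: (le_trans (integral_dist_le bb mF osc _ _ Bk)); rewrite lee_fin.
apply: ler_pM => //.
  by rewrite addr_ge0// ltW.
have -> : k.+1%:R * (N * (2 + C)) = k.+1%:R * N + k.+1%:R * (N * (1 + C)) by ring.
by rewrite lerD// ler_peMl ?(ltW N0)// ler1n.
Qed.

Let coef k := c2 * (omega (L ^- k) * (L ^- k / m A)).

Let omL k : 0 <= omega (L ^- k).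
Proof.
case: om => + _ _ => /(_ (L ^- k)) => h.
by have /andP[/ltW] : 0 < omega (L ^- k) <= 1 by apply: h; rewrite invr_gt0 Lk0/= invf_le1.
Qed.

Let coef0 k : 0 <= coef k.
Proof. by rewrite /coef !mulr_ge0// ?invr_ge0 ltW. Qed.

(** Choose [k] with the volume distance between [L ^+ k * m A] and [L ^+ k.+1 * m A]. Some ball
    around [A] and [x] is then absorbed by [B k], and monotonicity of [omega] turns [phi_le] into
    [coef k]. *)
Let phi_shell x : exists2 k, B k x & phi x <= coef k.
Proof.
set v := vol_dist mu Bs x A.
have vA : m A <= v by exact: (vol_dist_ge bb).
have v0 : 0 < v by exact: lt_le_trans vA.
have ex : exists n, v < L ^+ n * m A.
  exists (Num.bound (v / m A)); rewrite -ltr_pdivrMr//.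
  apply: (lt_le_trans (archi_boundP _)); first by rewrite divr_ge0 ?ltW.
  apply: (@le_trans _ _ (2 ^+ Num.bound (v / m A))).
    by rewrite -natrX ler_nat ltnW// ltn_expl.
  by apply: lerXn2r; rewrite ?nnegrE; have := Keta; lra.
have [[|k] ltv minv] := ex_minnP ex.
  by move: ltv; rewrite mul1r ltNge vA.
have gev : L ^+ k * m A <= v.
  by rewrite leNgt; apply/negP => /minv; rewrite ltnn.
have [A1 [BA1 AA1 A1x A1lt]] := vol_dist_ltP bb x _ _ BA ltv.
exists k; first by have [_ _ _ sub] := BP k; exact: (sub A1).
apply: (le_trans (phi_le x)); rewrite -/v /coef ler_pM2l//.
have Av : m A / v <= L ^- k.
  by rewrite ler_pdivrMr// mulrC ler_pdivlMr// mulrC.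
apply: ler_pM.
- have [+ _ _] := om => /(_ (m A / v)) h.
  have /andP[/ltW//] : 0 < omega (m A / v) <= 1.
  by apply: h; rewrite divr_gt0//= ler_pdivrMr// mul1r.
- by rewrite invr_ge0 ltW.
- have [_ + _] := om; apply => //; first by rewrite divr_gt0.
  by rewrite invf_le1.
- by rewrite -invfM lef_pV2 ?posrE// mulr_gt0.
Qed.

(** By [phi_shell], [phi] is dominated by the sum of the [coef k] times the indicators of the [B k].
    The growth [L ^+ k] of the measures cancels the decay in [coef k]; the drift of the means leaves
    the factor [k.+1]. *)
Lemma kernel_oscillation :
  (\int[mu]_x (`|F x - a A| * phi x)%:E <= (kernel_const * N)%:E)%E.
Proof.
pose g x := `|F x - a A|%:E.
have mg D : measurable_fun D g by exact: measurable_dist.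
have mB k : measurable (B k) by have [+ _ _ _] := BP k; exact: (ball_measurable bb).
have gB0 k x : (0 <= (coef k)%:E * (g \_ (B k)) x)%E.
  by rewrite mule_ge0 ?lee_fin// patchE; case: ifP => //; rewrite lee_fin.
have mgB k : measurable_fun setT (g \_ (B k)).
  exact: ((measurable_restrictT g (mB k)).1 (mg _)).
apply: (@le_trans _ _
    (\int[mu]_x \sum_(0 <= k <oo) ((coef k)%:E * (g \_ (B k)) x))%E).
  apply: ge0_le_integral => //.
  - by move=> x _; rewrite lee_fin mulr_ge0.
  - apply/measurable_EFinP; apply: measurable_funM => //.
    by apply/measurable_EFinP; exact: mg.
  - by apply: (@ge0_emeasurable_sum _ _ _ _ _ xpredT) => // k _; exact: measurable_funeM.
  - move=> x _; have [k Bkx lek] := phi_shell x.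
    apply: le_trans (nneseries_lim_ge k.+1 _) => //.
    rewrite big_nat_recr//=; apply: le_trans (leeDr _ _); last by rewrite sume_ge0.
    by rewrite patchE mem_set// -EFinM lee_fin mulrC ler_wpM2r.
rewrite integral_nneseries//; last by move=> k; exact: measurable_funeM.
apply: (@le_trans _ _ (\sum_(0 <= k <oo)
    ((c2 * (C * (2 + C)) * N)%:E * (k.+1%:R * omega (L ^- k))%:E))%E).
  apply: lee_nneseries => [k _ _|k _]; first by rewrite integral_ge0.
  rewrite ge0_integralZl_EFin//; last first.
    by move=> x _; rewrite patchE; case: ifP => //; rewrite lee_fin.
  rewrite -integral_mkcond; apply: (le_trans (lee_wpmul2l _ (piece k))).
    by rewrite lee_fin.
  rewrite -!EFinM lee_fin /coef exprS.
  rewrite le_eqVlt; apply/orP; left; apply/eqP; field.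
  by rewrite !gt_eqF.
rewrite nneseriesZl => [|k _]; last by rewrite lee_fin mulr_ge0.
have L1 : 1 < L by have := Keta; lra.
apply: (le_trans (lee_wpmul2l _ (modulus_series_le om L1 normW))).
  by rewrite lee_fin !mulr_ge0 ?(ltW N0) ?(ltW c20)//; have := Keta; have := C0; lra.
rewrite -EFinM lee_fin /kernel_const le_eqVlt; apply/orP; left; apply/eqP.
by ring.
Qed.

Context (F0 : forall x, 0 <= F x) (a0 : 0 <= a A).
Context (phi1 : (\int[mu]_x (phi x)%:E = 1)%E).

(** The kernel has mass 1, so [a A] is its own average. Both bounds come from adding integrals of
    nonnegative functions, as the integral of [F * phi] is not known beforehand to be finite. *)
Lemma kernel_mean : ((a A - kernel_const * N)%:E <= \int[mu]_x (F x * phi x)%:E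
  <= (a A + kernel_const * N)%:E)%E.
Proof.
have mfun (f : T -> R) : measurable_fun setT f ->
    measurable_fun setT (fun x => (f x * phi x)%:E).
  by move=> mf; apply/measurable_EFinP; exact: measurable_funM.
have mdist : measurable_fun setT (fun x => `|F x - a A|).
  by apply/measurable_EFinP; exact: measurable_dist.
have a_int : (\int[mu]_x (a A * phi x)%:E = (a A)%:E)%E.
  under eq_integral do rewrite EFinM.
  rewrite ge0_integralZl_EFin//; [|by move=> x _; rewrite lee_fin|exact/measurable_EFinP].
  by rewrite phi1 mule1.
apply/andP; split.
  rewrite EFinB leeBlDl// -a_int.
  apply: (@le_trans _ _ (\int[mu]_x ((`|F x - a A| * phi x)%:E + (F x * phi x)%:E))%E).
    apply: ge0_le_integral => //.
    - by move=> x _; rewrite lee_fin mulr_ge0.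
    - exact: (mfun (cst (a A))).
    - by apply: emeasurable_funD; exact: mfun.
    - move=> x _; rewrite -EFinD lee_fin -mulrDl ler_wpM2r//.
      by have := ler_norm (a A - F x); rewrite distrC; lra.
  rewrite ge0_integralD//; [|by move=> x _; rewrite lee_fin mulr_ge0|exact: mfun
    |by move=> x _; rewrite lee_fin mulr_ge0|exact: mfun].
  by rewrite leeD2r// kernel_oscillation.
rewrite EFinD addeC -a_int.
apply: (@le_trans _ _ (\int[mu]_x ((`|F x - a A| * phi x)%:E + (a A * phi x)%:E))%E).
  apply: ge0_le_integral => //.
  - by move=> x _; rewrite lee_fin mulr_ge0.
  - exact: mfun.
  - by apply: emeasurable_funD; [exact: mfun|exact: (mfun (cst (a A)))].
  - move=> x _; rewrite -EFinD lee_fin -mulrDl ler_wpM2r//.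
    by have := ler_norm (F x - a A); lra.
rewrite ge0_integralD//; [|by move=> x _; rewrite lee_fin mulr_ge0|exact: mfun
  |by move=> x _; rewrite lee_fin mulr_ge0|exact: (mfun (cst (a A)))].
by rewrite leeD2r// kernel_oscillation.
Qed.

End KernelMean.

(** * Bochner means *)

Section SimpleFunctions.
Context {d : measure_display} {T : measurableType d} {R : realType}.
Context {mu : {measure set T -> \bar R}} {U : completeNormedModType R}.

Lemma measurable_simple_comp (s : T -> U) (h : U -> R) :
  simple_fun s -> measurable_fun setT (h \o s).
Proof.
move=> [fs ms] _ Y mY; rewrite setTI.
have -> : (h \o s) @^-1` Y =
    \bigcup_(u in range s `&` h @^-1` Y) s @^-1` [set u].
  apply/seteqP; split=> [x Yx|x [u [_ Yu] su]].
    by exists (s x) => //; split=> //; exists x.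
  by rewrite /preimage/= su.
by apply: fin_bigcup_measurable => //; exact: finite_setIl.
Qed.

Lemma integral_simple_comp (D : set T) (s : T -> U) (h : U -> R) :
  measurable D -> simple_fun s -> (forall u, 0 <= h u) ->
  (\int[mu]_(x in D) (h (s x))%:E =
   \sum_(u \in range s) (h u)%:E * mu (D `&` s @^-1` [set u]))%E.
Proof.
move=> mD [fs ms] h0.
under eq_integral => x _.
  rewrite (_ : (h (s x))%:E = \sum_(u \in range s)
      ((h u)%:E * (\1_(s @^-1` [set u]) x)%:E)%E)%E; last first.
    rewrite (fsbigD1 (s x))// indicE mem_set// mule1 fsbig1 => [|u [_ /= us]].
      by rewrite /= adde0.
    by rewrite indicE memNset ?mule0//= => /esym.
  over.
have mind u : measurable_fun D (fun x => (\1_(s @^-1` [set u]) x : R)%:E).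
  by apply/measurable_EFinP; exact: measurable_indic.
rewrite ge0_integral_fsum//.
- apply: eq_fsbigr => u _; rewrite ge0_integralZl_EFin//.
  by rewrite integral_indic// setIC.
- by move=> u; exact: measurable_funeM.
- by move=> u x _; rewrite mule_ge0// lee_fin.
Qed.

Lemma simple_integral_dist_le (D : set T) (s : T -> U) (a : U) :
  measurable D -> (mu D < +oo)%E -> simple_fun s ->
  (`|simple_integral mu D s - fine (mu D) *: a|%:E
    <= \int[mu]_(x in D) `|s x - a|%:E)%E.
Proof.
move=> mD Doo ss; have [fs ms] := ss.
have Dfin u : mu (D `&` s @^-1` [set u]) = (fine (mu (D `&` s @^-1` [set u])))%:E.
  rewrite fineK// ge0_fin_numE//; apply: le_lt_trans Doo.
  by apply: le_measure; rewrite ?inE//; exact: measurableI.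
have muD : fine (mu D) = \sum_(u \in range s) fine (mu (D `&` s @^-1` [set u])).
  have := @integral_simple_comp D s (cst 1) mD ss (fun=> ler01).
  rewrite /= integral_cst// mul1e => ->.
  rewrite !fsbig_finite//=.
  under eq_bigr do rewrite mul1e Dfin.
  by rewrite sumEFin.
rewrite (@integral_simple_comp D s (fun u => `|u - a|))// /simple_integral muD.
rewrite !fsbig_finite//= scaler_suml -sumrB.
under [leRHS]eq_bigr do rewrite Dfin -EFinM.
rewrite sumEFin lee_fin; apply: (le_trans (ler_norm_sum _ _ _)).
apply: ler_sum => u _; rewrite -scalerBr normrZ ger0_norm ?fine_ge0// mulrC.
exact: lexx.
Qed.

Lemma measurable_norm_dist (f : T -> U) (c : U) :
  strongly_measurable f -> measurable_fun setT (fun x => `|f x - c|).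
Proof.
move=> [s [ss sf]].
apply: (@measurable_fun_cvg _ _ _ _ (fun n x => `|s n x - c|)) => [n|x _].
  exact: (measurable_simple_comp _ (fun u => `|u - c|) (ss n)).
by apply: cvg_norm; apply: cvgB; [exact: sf|exact: cvg_cst].
Qed.

End SimpleFunctions.

(** * Bochner means of nonnegative real functions *)

Section RealMean.
Import HBSimple HBNNSimple.
Context {d : measure_display} {T : measurableType d} {R : realType}.
Context {mu : {measure set T -> \bar R}}.
Context {g : T -> R} (mg : measurable_fun setT g) (g0 : forall x, 0 <= g x).

Lemma nnsfun_approx : exists s : nat -> {nnsfun T >-> R},
  [/\ forall n, simple_fun ((s n : T -> R) : T -> R^o), forall n x, 0 <= s n x <= g x
    & forall x, s n x @[n --> \oo] --> g x].
Proof.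
have [||s [homo_s sg]] := @approximation _ T R setT measurableT (EFin \o g).
- exact/measurable_EFinP.
- by move=> x _ /=; rewrite lee_fin.
have cvgs x : s n x @[n --> \oo] --> g x by exact: (fine_cvg (sg x I)).
exists s; split=> [n|n x|//].
  split; first exact: fimfunP.
  by move=> u; rewrite -[X in measurable X]setTI; exact: (measurable_funP (s n)).
rewrite fun_ge0/= -(cvg_lim (@Rhausdorff R) (cvgs x)).
apply: nondecreasing_cvgn_le; last by apply/cvg_ex; exists (g x).
by move=> i j /homo_s/lefP/(_ x).
Qed.

Lemma strongly_measurable_ge0 : strongly_measurable (g : T -> R^o).
Proof. by have [s [ss _ sg]] := nnsfun_approx; exists (fun n => s n : T -> R). Qed.

Context {B : set T} (mB : measurable B) (Boo : (mu B < +oo)%E).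
Context (goo : (\int[mu]_(x in B) (g x)%:E < +oo)%E).

(** Guarantees that [bochner_integral] does not fall back on its default. Simple functions increase
    to [g], and dominated convergence applies with [g] itself as the bound. *)
Lemma has_bochner_integral_ge0 :
  has_bochner_integral mu B (g : T -> R^o) (fine (\int[mu]_(x in B) (g x)%:E)).
Proof.
have [s [ss s0g sg]] := nnsfun_approx.
have mgB : measurable_fun B (EFin \o g) by apply/measurable_EFinP; exact: measurable_funTS.
have ig : mu.-integrable B (EFin \o g).
  apply/integrableP; split=> //.
  by rewrite (eq_integral (fun x => (g x)%:E))// => x _; rewrite /= ger0_norm.
have ms n : measurable_fun B (fun x => (s n x)%:E).
  by apply/measurable_EFinP; exact: measurable_funTS.
have [||_ cvg1 cvg2] := @dominated_convergence _ _ _ mu B mB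
  (fun n x => (s n x)%:E) (EFin \o g) (EFin \o g) ms mgB _ ig.
- by apply: aeW => x _; apply: cvg_EFin; [exact: nearW|exact: sg].
- by apply: aeW => x n _ /=; have /andP[? ?] := s0g n x; rewrite lee_fin ger0_norm.
exists (fun n => s n : T -> R); split=> //.
- move=> n u _; apply: le_lt_trans Boo; apply: le_measure; rewrite ?inE//.
- apply: cvg_trans cvg1; apply: near_eq_cvg; apply: nearW => n /=.
  by apply: eq_integral => x _; rewrite distrC.
- have sE n : simple_integral mu B ((s n : T -> R) : T -> R^o) =
      fine (\int[mu]_(x in B) (s n x)%:E).
    under eq_integral => x _.
      rewrite -[s n x]ger0_norm; last by have /andP[] := s0g n x.
      over.
    have := @integral_simple_comp _ _ _ mu R^o B _ (fun u => `|u|) mB (ss n)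
      (fun u => normr_ge0 u).
    move=> /= ->; rewrite /simple_integral !fsbig_finite; [|exact: (ss n).1..].
    have mu_fin u : mu (B `&` s n @^-1` [set u]) \is a fin_num.
      rewrite ge0_fin_numE//; apply: le_lt_trans Boo.
      by apply: le_measure; rewrite ?inE//; apply: measurableI => //; exact: (ss n).2.
    rewrite -sum_fine => [|u _]; last by rewrite fin_numM.
    apply: eq_big_seq => u; rewrite in_fset_set; last exact: (ss n).1.
    rewrite inE => -[x _ <-]; rewrite fineM//= ger0_norm; last by have /andP[] := s0g n x.
    by rewrite mulrC.
  under eq_fun do rewrite sE.
  apply: fine_cvg; rewrite fineK; first exact: cvg2.
  by rewrite ge0_fin_numE// integral_ge0// => x _; rewrite lee_fin.
Qed.

Let bochner_integralP : has_bochner_integral mu B (g : T -> R^o)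
  (bochner_integral mu B (g : T -> R^o)).
Proof. exact: (xgetI 0 has_bochner_integral_ge0). Qed.

(** The inequality holds, up to the approximation error, along the simple functions witnessing
    whichever value [xget] picked, and passes to the limit. *)
Lemma bochner_integral_dist_le (a : R) :
  (`|bochner_integral mu B (g : T -> R^o) - fine (mu B) * a|%:E
    <= \int[mu]_(x in B) `|g x - a|%:E)%E.
Proof.
have [s [ss _ cvg1 cvg2]] := bochner_integralP.
have ms n : measurable_fun setT (s n : T -> R).
  exact: (measurable_simple_comp _ (fun u : R^o => u : R) (ss n)).
apply: (lee_cvg_to (a := eventually) (f := fun n => `|simple_integral mu B (s n) - fine (mu B) * a|%:E)
  (g := fun n => (\int[mu]_(x in B) `|g x - s n x|%:E
                  + \int[mu]_(x in B) `|g x - a|%:E)%E)).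
- apply: cvg_EFin; first by apply: nearW => n.
  exact: (cvg_norm (cvgB cvg2 (cvg_cst (fine (mu B) * a : R^o)))).
- rewrite -[X in _ --> X]add0e; apply: cvgeD.
  + by rewrite fin_num_adde_defr.
  + exact: cvg1.
  + exact: cvg_cst.
- apply: nearW => n.
  apply: (le_trans (simple_integral_dist_le _ _ a mB Boo (ss n))).
  have mB1 (h : T -> R) : measurable_fun setT h ->
      measurable_fun B (fun x => `|h x|%:E).
    move=> mh; apply/measurable_EFinP; apply: measurable_funTS.
    exact: measurableT_comp.
  rewrite -ge0_integralD//; [|by apply: mB1; exact: measurable_funB..].
  apply: ge0_le_integral => //.
  + by apply: mB1; exact: measurable_funB.
  + by apply: emeasurable_funD; apply: mB1; exact: measurable_funB.
  + move=> x _; rewrite -EFinD lee_fin (distrC (g x) (s n x)).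
    exact: ler_distD.
Qed.

(** Oscillation about any convenient constant suffices: replacing it by the mean costs a factor
    2. *)
Lemma mean_oscillation_le (a : R) : 0 < fine (mu B) ->
  (\int[mu]_(x in B) `|g x - mean mu (g : T -> R^o) B|%:E <=
   2%:E * \int[mu]_(x in B) `|g x - a|%:E)%E.
Proof.
move=> B0; set b := mean mu (g : T -> R^o) B.
have muB : mu B = (fine (mu B))%:E by rewrite fineK// ge0_fin_numE.
have mdist (c : R) : measurable_fun B (fun x => `|g x - c|%:E).
  apply/measurable_EFinP; apply: measurable_funTS.
  by apply: measurableT_comp => //; exact: measurable_funB.
apply: (@le_trans _ _ (\int[mu]_(x in B) (`|g x - a|%:E + (cst `|a - b|%:E) x)))%E.
  apply: ge0_le_integral => //.
  - by apply: emeasurable_funD.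
  - by move=> x _; rewrite -EFinD lee_fin; exact: ler_distD.
rewrite ge0_integralD//; [|by move=> x _; rewrite lee_fin].
rewrite integral_cst// mule_natl mule2n leeD2l//.
apply: le_trans (bochner_integral_dist_le a).
have <- : fine (mu B) * b = bochner_integral mu B (g : T -> R^o).
  by rewrite /b /mean [LHS]mulrA mulfV ?gt_eqF// mul1r.
by rewrite muB -EFinM lee_fin -mulrBr normrM (ger0_norm (ltW B0)) mulrC distrC.
Qed.

End RealMean.

(** * The maximal function *)

Section MaximalFunction.
Context {d : measure_display} {T : measurableType d} {R : realType}.
Context {mu : {measure set T -> \bar R}} {Bs : set (set T)} {K eta : R}.
Context (bb : ball_basis mu Bs K) (sep : separable_basis Bs).
Context (db : doubling mu Bs eta) (K1 : 1 <= K) (eta1 : 1 < eta).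
Context {F : T -> R} (mF : measurable_fun setT F) (F0 : forall x, 0 <= F x).
Context {a : set T -> R} {N : R} (N0 : 0 < N).
Local Notation m A := (fine (mu A)).
Context (osc : forall A, Bs A ->
  (\int[mu]_(x in A) `|F x - a A|%:E <= (N * m A)%:E)%E).
Context {I : set T -> \bar R} {D : R} (D0 : 0 <= D).
Context (I_mean : forall A, Bs A -> ((a A - D)%:E <= I A <= (a A + D)%:E)%E).
Context {G : T -> set (set T)} (Gx : forall x, complete_at mu Bs eta x (G x)).
Context {r : R} (r1 : 1 <= r) (Fr : (\int[mu]_x (F x `^ r)%:E < +oo)%E).

Local Notation M x := (ereal_sup [set I B | B in G x]).
Local Notation hull := (hull mu Bs K).
Local Notation step := (jn_step K eta * N).
Local Notation jn_set := (jn_set mu Bs a step).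

Let step_gt0 : 0 < step.
Proof.
have k1 := K1; have e1 := eta1; rewrite mulr_gt0// /jn_step /jn_gap.
have h1 : 0 <= K * (K + eta) by rewrite mulr_ge0//; lra.
have h2 : 0 <= K ^+ 2 * (2 + K) by rewrite mulr_ge0 ?exprn_ge0//; lra.
lra.
Qed.

(** Since [F <= 1 + F ^ r], means over balls of measure bounded below are bounded; this makes the
    supremum over [far B] a real number. *)
Lemma mean_le_of_Lr A : Bs A ->
  a A <= N + 1 + fine (\int[mu]_x (F x `^ r)%:E) / m A.
Proof.
move=> BA; have mA := ball_mu_gt0 bb _ BA; have mA' := ball_measurable bb BA.
set J := (\int[mu]_x _)%E.
have mFr : measurable_fun setT (fun x => (F x `^ r)%:E).
  apply/measurable_EFinP.
  exact: (measurableT_comp (measurable_powR r)).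
have Jfin : J \is a fin_num.
  by rewrite ge0_fin_numE// integral_ge0// => x _; rewrite lee_fin powR_ge0.
have : (((a A - N) * m A)%:E <= (m A)%:E + J)%E.
  apply: (@le_trans _ _ ((`|a A - 0| - N) * m A)%:E).
    by rewrite subr0 lee_fin ler_wpM2r ?(ltW mA)// lerD2r ler_norm.
  apply: (le_trans (integral_dist_ge bb mF osc _ _ BA)).
  apply: (@le_trans _ _ (\int[mu]_(x in A) (cst 1 x + (F x `^ r)%:E))%E).
    apply: ge0_le_integral => //.
    - exact: measurable_dist.
    - by apply: emeasurable_funD => //; exact: measurable_funTS.
    - move=> x _ /=; rewrite -EFinD lee_fin subr0 ger0_norm//.
      have [Fx1|Fx1] := leP (F x) 1; first by rewrite ler_wpDr// powR_ge0.
      by rewrite ler_wpDl// le1r_powR// ltW.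
  rewrite ge0_integralD//; last 2 first.
  - by move=> x _; rewrite lee_fin powR_ge0.
  - exact: measurable_funTS.
  rewrite integral_cst// mul1e (ball_muE bb _ BA) leeD2l//.
  apply: ge0_subset_integral => //.
  by move=> x _; rewrite lee_fin powR_ge0.
rewrite -(fineK Jfin) -EFinD lee_fin -ler_pdivlMr// mulrDl mulfV ?gt_eqF//.
lra.
Qed.

(** [G x] need not contain [A], but contains a larger ball of comparable measure, whose mean differs
    by at most [N * (1 + eta)]. *)
Lemma maximal_lower x A : Bs A -> A x -> ((a A - N * (1 + eta) - D)%:E <= M x)%E.
Proof.
move=> BA Ax; have [GB _ /(_ A BA Ax)[A' [GA' AA' leA']]] := Gx x.
have BA' := GB _ GA'.
apply: (@le_trans _ _ (I A')); last by apply: ereal_sup_ubound; exists A'.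
have /andP[+ _] := I_mean _ BA'; apply: le_trans; rewrite lee_fin lerD2r.
have : `|a A - a A'| <= N * (1 + eta).
  apply: (mean_dist_le bb mF N0 osc) => //.
  by rewrite -lee_fin EFinM -!(ball_muE bb).
by move=> /ler_normlP[_]; lra.
Qed.

(** Its supremum is the constant about which the maximal function oscillates on [B]; it does not
    depend on the point of [B]. *)
Let far B := [set a A | A in [set A | [/\ Bs A, m B <= m A & A `&` B !=set0]]].

Let has_sup_far B : Bs B -> has_sup (far B).
Proof.
move=> BB; split.
  by exists (a B); exists B => //; split=> //; rewrite setIid; exact: (ball_nonempty bb).
exists (N + 1 + fine (\int[mu]_x (F x `^ r)%:E) / m B) => _ [A [BA BleA _] <-].
apply: (le_trans (mean_le_of_Lr _ BA)); rewrite lerD2l ler_wpM2l//.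
  by rewrite fine_ge0// integral_ge0// => x _; rewrite lee_fin powR_ge0.
by rewrite lef_pV2// posrE; exact: (ball_mu_gt0 bb).
Qed.

Lemma maximal_upper B x k : Bs B -> B x -> ~ jn_set k B x ->
  (M x <= (sup (far B) + k%:R * step + D)%:E)%E.
Proof.
move=> BB Bx nkx; have [GB Gmem _] := Gx x.
have ub_far := ub_le_sup (has_sup_far _ BB).2.
apply: ge_ereal_sup => _ [A GA <-]; have BA := GB _ GA; have Ax := Gmem _ GA.
have /andP[_] := I_mean _ BA; move/le_trans; apply; rewrite lee_fin lerD2r.
have AB : A `&` B !=set0 by exists x.
have ks : 0 <= k%:R * step by rewrite mulr_ge0// ltW.
have [BleA|AltB] := leP (m B) (m A).
  have : a A <= sup (far B) by apply: ub_far; exists A.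
  lra.
have aB : a B <= sup (far B).
  by apply: ub_far; exists B => //; split=> //; rewrite setIid; exact: (ball_nonempty bb).
have [|gapA] := leP (a A) (a B + k%:R * step); first lra.
by exfalso; apply: nkx; exists A => //; split=> //; exact: ltW.
Qed.

(** A large ball [A] meeting [B] may miss [x], but [hull A] contains [B]. Its mean is within
    [N * (1 + K)] of [a A], and [maximal_lower] applies to it. *)
Lemma maximal_lower_far B x : Bs B -> B x ->
  (M x < +oo)%E -> sup (far B) <= fine (M x) + (2 + K + eta) * N + D.
Proof.
move=> BB Bx Moo; apply: ge_sup; first exact: (has_sup_far _ BB).1.
move=> _ [A [BA BleA AB] <-].
have [BH mH subH] := hullP bb _ BA.
have Hx : hull A x.
  apply: (subH B) => //; last by rewrite setIC.
  by have := ball_mu_gt0 bb _ BA; lra.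
have h := maximal_lower _ _ BH Hx.
have Mfin : M x \is a fin_num.
  by rewrite fin_real// Moo andbT (lt_le_trans _ h)// ltNyr.
have := mean_dist_hull bb mF N0 osc _ BA.
move=> /ler_normlP[_]; move: h; rewrite -[X in (_ <= X)%E](fineK Mfin) lee_fin.
have -> : (2 + K + eta) * N = N * (1 + eta) + N * (1 + K) by ring.
lra.
Qed.

(** The step times the number of levels whose set contains [x], which dominates the excess of the
    maximal function due to small balls. *)
Let layers B x : \bar R := (\sum_(0 <= k <oo) (step * \1_(jn_set k B) x)%:E)%E.

Let layers_ge B x k : (forall i, (i < k)%N -> jn_set i B x) ->
  ((k%:R * step)%:E <= layers B x)%E.
Proof.
move=> jx; apply: (@le_trans _ _ (\sum_(0 <= i < k) (step * \1_(jn_set i B) x)%:E)%E).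
  rewrite sumEFin lee_fin mulr_natl -[in leLHS](subn0 k) -sumr_const_nat.
  rewrite big_nat_cond [leRHS]big_nat_cond.
  apply: ler_sum => i /andP[/andP[_ ik] _].
  by rewrite indicE mem_set ?mulr1//; exact: jx.
by apply: nneseries_lim_ge => n _ _; rewrite lee_fin mulr_ge0// ltW.
Qed.

(** Let [k] be the first level not containing [x]: [maximal_upper] applies at [k], and the lower
    levels already contribute [k * step]. If there is no such level, [layers] exceeds every real
    number, so the value that [fine] takes at an infinite point is harmless. *)
Lemma maximal_oscillation_pointwise B x : Bs B -> B x ->
  (`|fine (M x) - sup (far B)|%:E <= ((2 + K + eta) * N + D)%:E + layers B x)%E.
Proof.
move=> BB Bx; have k1 := K1; have e1 := eta1.
have c0 : 0 <= (2 + K + eta) * N by rewrite mulr_ge0 ?(ltW N0)//; lra.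
have [[k nk]|all_k] := pselect (exists k, x \notin jn_set k B); last first.
  have jx k : jn_set k B x.
    by apply: contrapT => nx; apply: all_k; exists k; rewrite memNset.
  set t := `|_|; pose k := Num.bound (t / step).
  apply: (@le_trans _ _ (k%:R * step)%:E).
    rewrite lee_fin -ler_pdivrMr//; apply/ltW/archi_boundP.
    by rewrite divr_ge0 ?normr_ge0 ?(ltW step_gt0).
  apply: (le_trans (layers_ge B x k _)) => //.
  by rewrite leeDr// lee_fin addr_ge0.
have [{nk}k nk mink] := ex_minnP (ex_intro (fun k => x \notin jn_set k B) k nk).
have ub := maximal_upper B x k BB Bx (fun h => negP nk (mem_set h)).
have Moo : (M x < +oo)%E by apply: (le_lt_trans ub); exact: ltry.
have lb := maximal_lower_far B x BB Bx Moo.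
have kl : ((k%:R * step)%:E <= layers B x)%E.
  apply: layers_ge => i ik; apply: contrapT => nx.
  by have := mink i; rewrite memNset// leqNgt ik => /(_ isT).
apply: (@le_trans _ _ (((2 + K + eta) * N + D)%:E + (k%:R * step)%:E)%E); last first.
  by rewrite leeD2l.
have ks : 0 <= k%:R * step by rewrite mulr_ge0// ltW.
have ub' : fine (M x) <= sup (far B) + k%:R * step + D.
  have Mfin : M x \is a fin_num.
    by rewrite fin_real// Moo andbT (lt_le_trans _ (maximal_lower x B BB Bx))// ltNyr.
  by rewrite -lee_fin fineK.
rewrite -EFinD lee_fin ler_norml; apply/andP; split; lra.
Qed.

Context (mM : measurable_fun setT (fun x => M x)).

Let g x := fine (M x).

Let mg : measurable_fun setT g.
Proof.
by apply: (measurableT_comp _ mM); exact: fine_measurable.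
Qed.

Let measurable_layer B k : measurable_fun setT (fun x => (step * \1_(jn_set k B) x)%:E).
Proof.
apply/measurable_EFinP; apply: measurable_funM => //.
by apply: measurable_indic; exact: measurable_jn_set.
Qed.

Let integral_layers B : Bs B ->
  (\int[mu]_(x in B) layers B x <= (2 * K * jn_step K eta * N * m B)%:E)%E.
Proof.
move=> BB; have mB := ball_measurable bb BB; have k1 := K1.
rewrite integral_nneseries//; last 2 first.
- by move=> k; apply: measurable_funTS; exact: measurable_layer.
- by move=> k x _; rewrite lee_fin mulr_ge0// ltW.
(* The bounds form a geometric series; with [2 ^ k.+1] as denominator it sums to the numerator. *)
apply: (@le_trans _ _
    (\sum_(0 <= k <oo) ((2 * K * jn_step K eta * N * m B) / (2 ^ k.+1)%:R)%:E)%E).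
  apply: lee_nneseries => [k _ _|k _].
    by rewrite integral_ge0// => x _; rewrite lee_fin mulr_ge0// ltW.
  under eq_integral do rewrite EFinM.
  have mj := measurable_jn_set sep k B : measurable (jn_set k B).
  rewrite ge0_integralZl_EFin ?(ltW step_gt0)//; last first.
    by apply/measurable_EFinP; exact: measurable_indic.
  rewrite integral_indic//.
  apply: (@le_trans _ _ (step%:E * (K * m B / 2 ^+ k)%:E)%E).
    apply: lee_wpmul2l; first by rewrite lee_fin ltW.
    apply: le_trans (jn_set_decay bb sep db K1 eta1 mF N0 osc k _ BB).
    by apply: le_measure; rewrite ?inE//; exact: measurableI.
  rewrite -EFinM lee_fin natrX exprS le_eqVlt; apply/orP; left; apply/eqP.
  by field; rewrite expf_neq0.
have K0 : 0 <= K by exact: le_trans ler01 K1.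
have step0 : 0 <= jn_step K eta by rewrite -(pmulr_lge0 _ N0) ltW.
by apply: epsilon_trick0; rewrite !mulr_ge0 ?(ltW N0).
Qed.

Lemma maximal_oscillation B : Bs B -> exists c : R,
  (\int[mu]_(x in B) `|g x - c|%:E <=
    ((2 + K + eta) * N * m B + D * m B + 2 * K * jn_step K eta * N * m B)%:E)%E.
Proof.
move=> BB; have mB := ball_measurable bb BB; have k1 := K1; have e1 := eta1.
have cD0 : 0 <= (2 + K + eta) * N + D.
  by rewrite addr_ge0// mulr_ge0 ?(ltW N0)//; lra.
have ml : measurable_fun B (layers B).
  apply: (@ge0_emeasurable_sum _ _ _ _ _ xpredT) => [k x _ _|k _].
    by rewrite lee_fin mulr_ge0// ltW.
  by apply: measurable_funTS; exact: measurable_layer.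
have l0 x : (0 <= layers B x)%E.
  by apply: nneseries_ge0 => k _ _; rewrite lee_fin mulr_ge0// ltW.
exists (sup (far B)).
apply: (@le_trans _ _ (\int[mu]_(x in B)
    (cst ((2 + K + eta) * N + D)%:E x + layers B x))%E).
  apply: ge0_le_integral => //.
  - exact: (measurable_dist mg).
  - exact: emeasurable_funD.
  - by move=> x Bx; exact: maximal_oscillation_pointwise.
rewrite ge0_integralD//.
rewrite integral_cst// (ball_muE bb _ BB) -EFinM -mulrDl EFinD leeD2l//.
exact: integral_layers.
Qed.

Let infinite_set := (fun x => M x) @^-1` [set +oo%E].

Let measurable_infinite_set : measurable infinite_set.
Proof.
rewrite -[infinite_set]setTI; apply: mM => //; exact: emeasurable_set1.
Qed.

(** By [maximal_upper], such points of [B] lie in every [jn_set k B], whose measures tend to 0. *)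
Let infinite_set_ball B : Bs B -> mu (infinite_set `&` B) = 0%E.
Proof.
move=> BB; have mB := ball_mu_gt0 bb _ BB.
have K0 : 0 <= K by exact: le_trans ler01 K1.
apply/eqP; rewrite eq_le measure_ge0 andbT; apply/lee_addgt0Pr => e e0.
rewrite add0e; pose k := Num.bound (K * m B / e).
apply: (@le_trans _ _ (mu (jn_set k B))).
  apply: le_measure; rewrite ?inE.
  - by apply: measurableI => //; exact: (ball_measurable bb).
  - exact: measurable_jn_set.
  - move=> x [Mx Bx]; apply: contrapT => /(maximal_upper _ _ _ BB Bx).
    by rewrite (Mx : M x = _) leye_eq.
apply: (le_trans (jn_set_decay bb sep db K1 eta1 mF N0 osc k _ BB)).
rewrite lee_fin ler_pdivrMr ?exprn_gt0// (mulrC e) -ler_pdivrMr//.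
apply: (@le_trans _ _ k%:R).
  by apply/ltW/archi_boundP; rewrite !mulr_ge0// ?invr_ge0 ltW.
by rewrite -natrX ler_nat ltnW// ltn_expl.
Qed.

(** (B3) applied to the whole space covers it by countably many balls up to measure [e], and the bad
    set is null in each of them. *)
Lemma maximal_ae_finite : {ae mu, forall x, (M x < +oo)%E}.
Proof.
suff Z0 : mu infinite_set = 0%E.
  exists infinite_set; split=> // x /= /negP; rewrite -leNgt leye_eq.
  by move=> /eqP.
apply/eqP; rewrite eq_le measure_ge0 andbT; apply/lee_addgt0Pr => e e0.
have [C [CB /pcard_surjP[h hC]]] := ball_approx bb measurableT e0.
rewrite setTYC => leC.
(* The enumeration [h] reaches every ball of [C], but its other values need not be balls. *)
pose Z n := if pselect (C (h n)) then infinite_set `&` h n else set0.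
have mZ n : measurable (Z n).
  rewrite /Z; case: pselect => //= Ch.
  by apply: measurableI => //; exact: (ball_measurable bb (CB _ Ch)).
have UZ0 : mu (\bigcup_n Z n) = 0%E.
  apply/negligibleP; first exact: bigcup_measurable.
  apply: negligible_bigcup => n; apply/negligibleP => //.
  rewrite /Z; case: pselect => //= Ch; exact: infinite_set_ball (CB _ Ch).
have mC : measurable (\bigcup_(B in C) B) by exact: sep.
have mD : measurable (~` \bigcup_(B in C) B) by exact: measurableC.
apply: (@le_trans _ _ (mu (~` (\bigcup_(B in C) B) `|` \bigcup_n Z n))).
  apply: le_measure; rewrite ?inE//.
    by apply: measurableU => //; exact: bigcup_measurable.
  move=> x Zx; have [[B CB' Bx]|nC] := pselect ((\bigcup_(B in C) B) x).
    right; have [n _ hn] := hC _ CB'; exists n => //.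
    by rewrite /Z; case: pselect => /= [_|]; rewrite hn.
  by left.
apply: (le_trans (measureU2 _ mD _)); first exact: bigcup_measurable.
by rewrite [X in (_ + X)%E]UZ0 adde0 add0e ltW.
Qed.

End MaximalFunction.

Lemma in_Lr_powR_lty {d} {T : measurableType d} {R : realType}
    {mu : {measure set T -> \bar R}} {U : completeNormedModType R}
    (r : R) (f : T -> U) :
  1 <= r -> in_Lr mu r f -> (\int[mu]_x (`|f x| `^ r)%:E < +oo)%E.
Proof.
move=> r1 [_ /(poweR_lty r)].
rewrite poweR_Lnorm ?gt_eqF//; last exact: lt_le_trans ltr01 r1.
by under eq_integral do rewrite /= normr_id.
Qed.

Lemma BMO_norm_ball_le {d} {T : measurableType d} {R : realType}
    {mu : {measure set T -> \bar R}} {Bs : set (set T)}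
    {U : completeNormedModType R} (f : T -> U) (N : R) (B : set T) :
  Bs B -> 0 < fine (mu B) -> (BMO_norm mu Bs f <= N%:E)%E ->
  (\int[mu]_(x in B) `|f x - mean mu f B|%:E <= (N * fine (mu B))%:E)%E.
Proof.
move=> BB B0 fN; set J := (\int[mu]_(x in B) _)%E.
have -> : J = ((fine (mu B))%:E * ((fine (mu B))^-1%:E * J))%E.
  by rewrite muleA -EFinM mulfV ?gt_eqF// mul1e.
rewrite mulrC EFinM; apply: lee_wpmul2l; first by rewrite lee_fin ltW.
by apply: le_trans fN; apply: ereal_sup_ubound; exists B.
Qed.

(** * Boundedness of the maximal function on BMO *)

Section Boundedness.
Context {d : measure_display} {T : measurableType d} {R : realType}.
Context {mu : {measure set T -> \bar R}} {Bs : set (set T)} {K eta : R}.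
Context (bb : ball_basis mu Bs K) (sep : separable_basis Bs).
Context (db : doubling mu Bs eta) (K1 : 1 <= K) (eta1 : 1 < eta).
Context {U : completeNormedModType R} {omega gam : R -> R} {W r c1 c2 : R}.
Context (om : modulus omega) (normW : modulus_norm omega = W%:E).
Context (r1 : 1 <= r) (c20 : 0 < c2).
Context {phi : set T -> T -> R} (reg : omega_regular mu Bs omega gam c1 c2 phi).
Context {G : T -> set (set T)} (Gx : forall x, complete_at mu Bs eta x (G x)).
Context {f : T -> U} (fLr : in_Lr mu r f).
Local Notation Mf := (maximal_fun mu phi G f).
Context (mM : measurable_fun setT Mf).
Context {N : R} (N0 : 0 < N) (fN : (BMO_norm mu Bs f <= N%:E)%E).
Local Notation m A := (fine (mu A)).
Local Notation C :=
  (2 + K + eta + kernel_const K eta c2 W + 2 * K * jn_step K eta).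

Let F x := `|f x|.
Let a A := `|mean mu f A|.

Let mF : measurable_fun setT F.
Proof.
have := measurable_norm_dist f 0 fLr.1.
by under eq_fun do rewrite subr0.
Qed.

(** Norms of the vector means serve as centres, so the reverse triangle inequality transfers the
    oscillation of [f] to its norm. *)
Let osc A : Bs A -> (\int[mu]_(x in A) `|F x - a A|%:E <= (N * m A)%:E)%E.
Proof.
move=> BA; have mA := ball_measurable bb BA.
apply: le_trans (BMO_norm_ball_le f N A BA (ball_mu_gt0 bb _ BA) fN).
apply: ge0_le_integral => //.
- exact: (measurable_dist mF).
- apply/measurable_EFinP; apply: measurable_funTS.
  exact: measurable_norm_dist fLr.1.
- by move=> x _; rewrite lee_fin; exact: ler_dist_dist.
Qed.

Let kernel A : Bs A -> ((a A - kernel_const K eta c2 W * N)%:E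
  <= \int[mu]_x (F x * phi A x)%:E <= (a A + kernel_const K eta c2 W * N)%:E)%E.
Proof.
move=> BA; have iphi := reg_integrable reg BA.
apply: (kernel_mean bb db K1 eta1 mF N0 osc om normW BA c20) => //.
- by move=> x; exact: (reg_ge0 reg).
- by apply/measurable_EFinP; exact: (measurable_int _ iphi).
- by move=> x; exact: (reg_upper reg).
- by move=> x; exact: normr_ge0.
- exact: normr_ge0.
- rewrite -(reg_norm reg BA) Lnorm1; apply: eq_integral => x _ /=.
  by rewrite ger0_norm//; exact: (reg_ge0 reg).
Qed.

(** The two bounds of [kernel] enclose a common value, which forces the sign. *)
Let D0 A : Bs A -> 0 <= kernel_const K eta c2 W * N.
Proof.
move=> BA; have /andP[lo hi] := kernel _ BA.
by have := le_trans lo hi; rewrite lee_fin; lra.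
Qed.

Lemma maximal_fun_ae_finite : {ae mu, forall x, (Mf x < +oo)%E}.
Proof.
exact: (maximal_ae_finite bb sep db K1 eta1 mF (fun x => normr_ge0 _) N0 osc
  kernel Gx r1 (in_Lr_powR_lty _ _ r1 fLr) mM).
Qed.

Let g x := fine (Mf x).

Let mg : measurable_fun setT g.
Proof. by apply: (measurableT_comp _ mM); exact: fine_measurable. Qed.

Lemma fine_maximal_ge0 x : 0 <= fine (Mf x).
Proof.
apply: fine_ge0; have [A [BA Ax _]] := ball_two_points bb x x.
have [GB _ /(_ A BA Ax)[A' [GA' _ _]]] := Gx x.
apply: (@le_trans _ _ (\int[mu]_y (`|f y| * phi A' y)%:E)%E).
  apply: integral_ge0 => y _; rewrite lee_fin mulr_ge0//.
  by apply: (reg_ge0 reg); exact: GB.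
by apply: ereal_sup_ubound; exists A'.
Qed.

Let oscillation B : Bs B -> exists c : R,
  (\int[mu]_(x in B) `|g x - c|%:E <= (C * N * m B)%:E)%E.
Proof.
move=> BB.
have [c hc] := maximal_oscillation bb sep db K1 eta1 mF (fun x => normr_ge0 _)
  N0 osc (D0 _ BB) kernel Gx r1 (in_Lr_powR_lty _ _ r1 fLr) mM B BB.
exists c; apply: (le_trans hc); rewrite lee_fin le_eqVlt; apply/orP; left.
by apply/eqP; ring.
Qed.

Lemma maximal_integrable_on_ball B : Bs B ->
  (\int[mu]_(x in B) (fine (Mf x))%:E < +oo)%E.
Proof.
move=> BB; have [c hc] := oscillation _ BB; have mB := ball_measurable bb BB.
apply: (@le_lt_trans _ _ (\int[mu]_(x in B) (`|g x - c|%:E + cst `|c|%:E x))%E).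
  apply: ge0_le_integral => //.
  - by move=> x _; rewrite lee_fin fine_maximal_ge0.
  - by apply/measurable_EFinP; exact: measurable_funTS.
  - by apply: emeasurable_funD => //; exact: (measurable_dist mg).
  - move=> x _ /=; rewrite -EFinD lee_fin.
    by have := ler_norm (g x - c); have := ler_norm c; rewrite /g; lra.
rewrite ge0_integralD//; [|exact: (measurable_dist mg)|by move=> x _; rewrite lee_fin].
rewrite integral_cst// (ball_muE bb _ BB) -EFinM lte_add_pinfty ?ltry//.
exact: le_lt_trans hc (ltry _).
Qed.

Lemma maximal_mean_oscillation B : Bs B ->
  ((m B)^-1%:E * \int[mu]_(x in B)
      `|fine (Mf x) - mean mu (fine \o Mf : T -> R^o) B|%:E <= (2 * C * N)%:E)%E.
Proof.
move=> BB; have [c hc] := oscillation _ BB; have mB := ball_mu_gt0 bb _ BB.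
have Boo : (mu B < +oo)%E by rewrite (ball_muE bb _ BB) ltry.
have := mean_oscillation_le mg fine_maximal_ge0 (ball_measurable bb BB) Boo
  (maximal_integrable_on_ball _ BB) c mB.
move=> /(@lee_wpmul2l _ (m B)^-1%:E) h.
apply: (le_trans (h _)); first by rewrite lee_fin invr_ge0 ltW.
apply: (@le_trans _ _ ((m B)^-1%:E * (2%:E * (C * N * m B)%:E))%E).
  apply: lee_wpmul2l; first by rewrite lee_fin invr_ge0 ltW.
  exact: lee_wpmul2l.
rewrite -!EFinM lee_fin le_eqVlt; apply/orP; left; apply/eqP.
by field; rewrite gt_eqF.
Qed.

End Boundedness.

Theorem corollary1p2 (R : realType) (K eta r c1 c2 W : R) (gam : R -> R)
  (eta_gt1 : 1 < eta) (r_ge1 : 1 <= r) (c1_gt0 : 0 < c1) (c2_gt0 : 0 < c2)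
  (gamP : growth_fun gam) :
  exists c : R, 0 < c /\
  forall (d : measure_display) (T : measurableType d)
    (mu : {measure set T -> \bar R}) (Bs : set (set T))
    (U : completeNormedModType R) (omega : R -> R)
    (phi : set T -> T -> R) (G : T -> set (set T)),
  ball_basis mu Bs K -> separable_basis Bs -> doubling mu Bs eta ->
  modulus omega -> modulus_norm omega = W%:E ->
  omega_regular mu Bs omega gam c1 c2 phi ->
  (forall x : T, complete_at mu Bs eta x (G x)) ->
  (* the maximal function acts from L^r(X, U) to measurable functions *)
  (forall g : T -> U, in_Lr mu r g ->
     measurable_fun setT (maximal_fun mu phi G g)) ->
  forall f : T -> U, in_Lr mu r f -> in_BMO mu Bs f ->
  let Mf := maximal_fun mu phi G f in
  [/\ {ae mu, forall x, (Mf x < +oo)%E},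
      in_BMO mu Bs (fine \o Mf : T -> R^o)
    & (BMO_norm mu Bs (fine \o Mf : T -> R^o) <= c%:E * BMO_norm mu Bs f)%E].
Proof.
(* The constant is fixed before the basis is known, so [1 <= K] cannot yet be deduced from a ball
   lying in its hull. *)
pose K' := Num.max K 1; have K'1 : 1 <= K' by rewrite le_max lexx orbT.
pose C := 2 * (2 + K' + eta + kernel_const K' eta c2 W + 2 * K' * jn_step K' eta).
(* The maximum with 1 makes [c] positive whatever the sign of [C]; positivity is used in the
   division [e / c] and for an empty basis. *)
exists (Num.max 1 C); set c := Num.max 1 C.
have c0 : 0 < c by rewrite lt_max ltr01.
split=> // d T mu Bs U omega phi G bbK sep db om normW reg Gx mM f fLr [_ _ foo] Mf.
have bb : ball_basis mu Bs K' by apply: ball_basis_weaken bbK; rewrite le_max lexx.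
have mMf := mM f fLr; rewrite -/Mf in mMf.
have Mf0 := fine_maximal_ge0 bb reg Gx (f := f).
have Mf_sm : strongly_measurable (fine \o Mf : T -> R^o).
  apply: strongly_measurable_ge0 => //.
  by apply: (measurableT_comp _ mMf); exact: fine_measurable.
(* An empty basis forces [T] to be empty, and the supremum defining the norm is then [-oo] on both
   sides. *)
have [Bs0|[B0 BB0]] : Bs = set0 \/ Bs !=set0.
  by have [->|/set0P] := eqVneq Bs set0; [left|right].
  have empty (x : T) : False.
    by have [A [+ _ _]] := ball_two_points bb x x; rewrite Bs0.
  have norm0 (V : completeNormedModType R) (h : T -> V) : BMO_norm mu Bs h = -oo%E.
    by rewrite /BMO_norm Bs0 image_set0 ereal_sup0.
  split.
  - by apply: aeW => x; case: (empty x).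
  - by split=> //; [move=> B; rewrite Bs0|rewrite norm0].
  - by rewrite !norm0 gt0_muleNy ?lte_fin.
have f0 : (0 <= BMO_norm mu Bs f)%E.
  apply: le_trans (ereal_sup_ubound _); last by exists B0.
  rewrite mule_ge0// ?lee_fin ?invr_ge0 ?fine_ge0//.
  by apply: integral_ge0 => x _; rewrite lee_fin.
have ffin : BMO_norm mu Bs f \is a fin_num by rewrite ge0_fin_numE.
set n := fine (BMO_norm mu Bs f).
have fn : BMO_norm mu Bs f = n%:E by rewrite fineK.
have n0 : 0 <= n by exact: fine_ge0.
(* The norm of [f] may vanish while the estimates require [0 < N]; they are applied with
   [N = n + e], and the excess is removed at the end. *)
have fN e : 0 < e -> (BMO_norm mu Bs f <= (n + e)%:E)%E.
  by move=> e0; rewrite fn lee_fin lerDl ltW.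
have ne e : 0 < e -> 0 < n + e by move=> e0; rewrite ltr_wpDl.
have bound : (BMO_norm mu Bs (fine \o Mf : T -> R^o) <= c%:E * BMO_norm mu Bs f)%E.
  apply: ge_ereal_sup => _ [B BB <-].
  apply/lee_addgt0Pr => e e0; have e'0 : 0 < e / c by rewrite divr_gt0.
  apply: (le_trans (maximal_mean_oscillation bb sep db K'1 eta_gt1 om normW r_ge1
    c2_gt0 reg Gx fLr mMf (ne _ e'0) (fN _ e'0) B BB)).
  rewrite fn -EFinM -EFinD lee_fin.
  have -> : c * n + e = c * (n + e / c) by field; rewrite gt_eqF.
  by rewrite ler_wpM2r ?(ltW (ne _ e'0))// le_max lexx orbT.
split=> //.
- exact: (maximal_fun_ae_finite bb sep db K'1 eta_gt1 om normW r_ge1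
    c2_gt0 reg Gx fLr mMf (ne _ ltr01) (fN _ ltr01)).
- split=> //.
  + move=> B BB.
    rewrite (eq_integral (fun x => (fine (Mf x))%:E)) => [|x _]; last first.
      by congr EFin; exact: (ger0_norm (Mf0 x)).
    exact: (maximal_integrable_on_ball bb sep db K'1 eta_gt1 om normW r_ge1
      c2_gt0 reg Gx fLr mMf (ne _ ltr01) (fN _ ltr01)).
  + by apply: (le_lt_trans bound); rewrite fn -EFinM ltry.
Qed.
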